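(* There is an absolute constant $C_1>0$ such that, writing $C_{1,\beta}=2^{-1/2}C_1(\beta^{-1}+1)$ for $\beta>0$, the following holds for $d=1$. Let $\alpha,\beta>0$ and $0<R_s\le\dfrac{\alpha^{1/8}}{2^{7/2}C_{1,\beta}^{1/4}}$. Then, for each choice of sign $\pm$ and every $f_\pm\in B(R_s)$, there exists a unique $f_0\in B(2R_s)$ such that the mild solution $f$ of the 6-wave kinetic equation corresponding to the initial data $f_0$ (exists and) satisfies $$\lim_{t\to\pm\infty}\|T^{-t}f(t)-f_\pm\|_{\alpha,\beta}=0.$$
   Context: Here $d=1$, $t\in\mathbb{R}$, $x,v\in\mathbb{R}^d$. ''Measurable'' means Borel measurable; functions of $(t,x,v)$ are jointly measurable. Spaces. $\mathcal{M}_{\alpha,\beta}$ is the space of measurable $g:\mathbb{R}^d\times\mathbb{R}^d\to\mathbb{R}$ with $\|g\|_{\alpha,\beta}:=\sup_{x,v}|g(x,v)|e^{\alpha|x|^2+\beta|v|^2}<\infty$. $L^\infty(\mathbb{R},\mathcal{M}_{\alpha,\beta})$ is the space of time-dependent functions $g(t,x,v)$ with $|||g|||_{\alpha,\beta}:=\sup_{t\in\mathbb{R}}\|g(t)\|_{\alpha,\beta}<\infty$. For $R>0$, $B(R)=\{g\in\mathcal{M}_{\alpha,\beta}:\|g\|_{\alpha,\beta}<R\}$. Transport. $(T^sg)(t,x,v):=g(t,x-sv,v)$. So $T^{-t}f(t)$ is the function $(x,v)\mapsto f(t,x+tv,v)$, and $T^{-s}\mathcal{C}_6[f](s,x,v)=\mathcal{C}_6[f](s,x+sv,v)$.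 Equation. The 6-wave kinetic equation with initial data $f_0$ is $\partial_tf+v\cdot\nabla_xf=\mathcal{C}_6[f]$, $f(t=0)=f_0$, where $$\mathcal{C}_6[f](t,x,v)=\int_{\mathbb{R}^{5d}}\delta(\Sigma)\delta(\Omega)\Big[f_3f_4f_5(ff_1+ff_2+f_1f_2)-ff_1f_2(f_3f_4+f_3f_5+f_4f_5)\Big]dv_1\cdots dv_5,$$ $f=f(t,x,v)$, $f_i=f(t,x,v_i)$, $\Sigma=v+v_1+v_2-v_3-v_4-v_5$, $\Omega=|v|^2+|v_1|^2+|v_2|^2-|v_3|^2-|v_4|^2-|v_5|^2$. Meaning of the deltas: $\delta(\Sigma)$ sets $v_5=v+v_1+v_2-v_3-v_4$; then, for fixed $v,v_1,v_2$, with $h(v_3,v_4)$ denoting $\Omega$ after this substitution, $\int_{\mathbb{R}^{2d}}\delta(h)F\,dv_3dv_4:=\int_{\{h=0\}}\frac{F}{|\nabla h|}\,d\mathcal{H}^{2d-1}$ (surface measure on the zero set of $h$ in $\mathbb{R}^{2d}$). Mild solution. For $f_0\in\mathcal{M}_{\alpha,\beta}$, a measurable $f:\mathbb{R}\times\mathbb{R}^d\times\mathbb{R}^d\to\mathbb{R}$ is a mild solution with initial data $f_0$ if $T^{-t}f(t)\in L^\infty(\mathbb{R},\mathcal{M}_{\alpha,\beta})$ and $T^{-t}f(t,x,v)=f_0(x,v)+\int_0^tT^{-s}\mathcal{C}_6[f](s,x,v)\,ds$ for all $t\in\mathbb{R}$. *)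

(* Defs.v *)
From HB Require Import structures.
From mathcomp Require Import all_boot all_order all_algebra.
From mathcomp Require Import all_classical all_reals all_analysis.

Set Implicit Arguments.
Unset Strict Implicit.
Unset Printing Implicit Defensive.

Import Order.TTheory GRing.Theory Num.Theory.
Import numFieldNormedType.Exports.

Local Open Scope classical_set_scope.
Local Open Scope ring_scope.

Section Hausdorff.
Context {R : realType}.
Implicit Types (p q : R * R) (A B : set (R * R)).

(* The norm of the library on [R * R] is the sup norm, hence this explicit
   Euclidean distance. *)
Definition edist p q : R := Num.sqrt ((p.1 - q.1) ^+ 2 + (p.2 - q.2) ^+ 2).

(* The supremum of the empty set is [-oo]; the maximum makes [ediam set0 = 0]. *)
Definition ediam A : \bar R :=
  maxe 0%E (ereal_sup [set (edist pq.1 pq.2)%:E | pq in A `*` A]).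

Definition fine_cover (delta : R) A : set ((set (R * R))^nat) :=
  [set C | A `<=` \bigcup_k C k /\ forall k, (ediam (C k) <= delta%:E)%E].

Definition hausdorff1_pre (delta : R) A : \bar R :=
  ereal_inf [set (\sum_(k <oo) ediam (C k))%E | C in fine_cover delta A].

(* One-dimensional Hausdorff outer measure on the Euclidean plane. *)
Definition hausdorff1 A : \bar R :=
  ereal_sup [set hausdorff1_pre delta A | delta in [set delta | 0 < delta]].

Lemma ediam_ge0 A : (0 <= ediam A)%E.
Proof. by rewrite /ediam le_max lexx. Qed.

Lemma ediam_set0 : ediam set0 = 0%E.
Proof. by rewrite /ediam set0X image_set0 ereal_sup0 max_l// leNye. Qed.

Lemma hausdorff1_pre_ge0 delta A : (0 <= hausdorff1_pre delta A)%E.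
Proof.
apply: le_ereal_inf_tmp => _ [C _ <-].
by apply: nneseries_ge0 => n _ _; exact: ediam_ge0.
Qed.

Lemma hausdorff1_pre_subset delta A B :
  A `<=` B -> (hausdorff1_pre delta A <= hausdorff1_pre delta B)%E.
Proof.
move=> AB; apply/ereal_inf_le_tmp => _ [C [BC dC] <-].
by exists C => //; split => //; exact: subset_trans BC.
Qed.

Lemma hausdorff1_pre_sigma_subadditive delta :
  sigma_subadditive (hausdorff1_pre delta).
Proof.
move=> A; have [[i ioo]|] := pselect (exists i, hausdorff1_pre delta (A i) = +oo%E).
  rewrite (eseries_pinfty _ _ ioo) ?leey// => n _.
  by rewrite -ltNye (lt_le_trans _ (hausdorff1_pre_ge0 _ _)).
rewrite -forallNE => Aoo.
suff add2e (e : {posnum R}) : (hausdorff1_pre delta (\bigcup_n A n) <=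
    \sum_(i <oo) hausdorff1_pre delta (A i) + e%:num%:E)%E.
  by apply/lee_addgt0Pr => _/posnumP[].
rewrite (le_trans _ (epsilon_trick _ _ _))//; last first.
  by move=> n; exact: hausdorff1_pre_ge0.
pose P n (C : (set (R * R))^nat) := fine_cover delta (A n) C /\
  (\sum_(k <oo) ediam (C k) <=
   hausdorff1_pre delta (A n) + (e%:num / (2 ^ n.+1)%:R)%:E)%E.
have [G PG] : {G : ((set (R * R))^nat)^nat & forall n, P n (G n)}.
  apply: (@choice _ _ P) => n; rewrite /P.
  have Afin : hausdorff1_pre delta (A n) \is a fin_num.
    by rewrite ge0_fin_numE ?hausdorff1_pre_ge0// ltey; apply/eqP/Aoo.
  have en1 : 0 < e%:num / (2 ^ n.+1)%:R by [].
  have [_ [C CA <-] CS] := lb_ereal_inf_adherent en1 Afin.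
  by exists C; split => //; exact: ltW.
have G0 x : (0 <= (ediam \o uncurry G) x)%E by exact: ediam_ge0.
apply: (@le_trans _ _ (\esum_(i in setT) (ediam \o uncurry G) i)%E).
  apply: ereal_inf_lbound => /=.
  have /card_esym/ppcard_eqP[f] := card_nat2.
  exists (uncurry G \o f).
    split => [t [i _ /((PG i).1.1)[j _ Gt]]|k]; last first.
      by rewrite /= /uncurry; case: (f k) => i j; exact: (PG i).1.2.
    by exists (f^-1%FUN (i, j)) => //=; rewrite invK ?inE.
  rewrite -(esum_pred_image (ediam \o uncurry G) _ xpredT) ?[fun=> _]set_true//.
  by rewrite image_eq.
have -> : (\esum_(i in setT) (ediam \o uncurry G) i =
    \sum_(i <oo) \sum_(j <oo) ediam (G i j))%E.
  rewrite nneseries_esumT => [|i]; last first.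
    by apply: nneseries_ge0 => j _ _; exact: (G0 (i, j)).
  rewrite (_ : ediam \o uncurry G = fun k => ediam (G k.1 k.2)); last first.
    by apply/funext => -[].
  rewrite (_ : [set: nat * nat] = [set: nat] `*`` (fun=> [set: nat])); last first.
    by apply/seteqP; split.
  rewrite -(esum_esum (a := fun i j => ediam (G i j)))//=; last first.
    by move=> i j _ _; exact: (G0 (i, j)).
  apply: eq_esum => i _; rewrite nneseries_esumT// => j; exact: (G0 (i, j)).
apply: lee_nneseries => [n _ _|n _]; last by case: (PG n).
by apply: nneseries_ge0 => m _ _; exact: (G0 (n, m)).
Qed.

Lemma hausdorff1_0 : hausdorff1 set0 = 0%E.
Proof.
apply/eqP; rewrite eq_le; apply/andP; split.
  apply: ge_ereal_sup => _ [delta /= delta0 <-].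
  apply: ereal_inf_lbound; exists (fun=> set0).
    by split => // k; rewrite ediam_set0 lee_fin ltW.
  by rewrite eseries0// => k _ _; exact: ediam_set0.
apply: (le_trans (hausdorff1_pre_ge0 1 set0)).
by apply: ereal_sup_ubound; exists 1 => //=.
Qed.

Lemma hausdorff1_ge0 A : (0 <= hausdorff1 A)%E.
Proof.
apply: (le_trans (hausdorff1_pre_ge0 1 A)).
by apply: ereal_sup_ubound; exists 1 => //=.
Qed.

Lemma hausdorff1_subset : {homo hausdorff1 : A B / A `<=` B >-> (A <= B)%E}.
Proof.
move=> A B AB; apply: ge_ereal_sup => _ [delta delta0 <-].
apply: (le_trans (hausdorff1_pre_subset delta AB)).
by apply: ereal_sup_ubound; exists delta.
Qed.

Lemma hausdorff1_sigma_subadditive : sigma_subadditive hausdorff1.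
Proof.
move=> A; apply: ge_ereal_sup => _ [delta delta0 <-].
apply: (le_trans (hausdorff1_pre_sigma_subadditive delta A)).
apply: lee_nneseries => n _ *; first exact: hausdorff1_pre_ge0.
by apply: ereal_sup_ubound; exists delta.
Qed.

HB.instance Definition _ := isOuterMeasure.Build R (R * R)%type hausdorff1
  hausdorff1_0 hausdorff1_ge0 hausdorff1_subset hausdorff1_sigma_subadditive.

Definition hausdorff1_outer : {outer_measure set (R * R) -> \bar R} :=
  hausdorff1.

End Hausdorff.

Definition caratheodory_measure {R : realType} {T : pointedType}
    (mu : {outer_measure set T -> \bar R}) :
    {measure set (caratheodory_type mu) -> \bar R} :=
  (mu : set (caratheodory_type mu) -> \bar R).

(* The Caratheodory sigma-algebra of [hausdorff1] contains the Borel sets of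
   the plane. *)
Definition hausdorff1_measure {R : realType} :=
  caratheodory_measure (@hausdorff1_outer R).

Section Kinetic.
Context {R : realType}.
Implicit Types (t x v s alpha beta r : R).

Local Notation leb := (@lebesgue_measure R).

(* Phase-space functions are [g x v]; time-dependent ones are [f t x v]. *)

Definition weighted_norm alpha beta (g : R -> R -> R) : \bar R :=
  ereal_sup [set (`|g p.1 p.2| *
    expR (alpha * `|p.1| ^+ 2 + beta * `|p.2| ^+ 2))%:E | p in [set: R * R]].

Definition weighted_space alpha beta : set (R -> R -> R) :=
  [set g | measurable_fun [set: R * R] (fun p => g p.1 p.2) /\
           (weighted_norm alpha beta g < +oo)%E].

Definition weighted_ball alpha beta r : set (R -> R -> R) :=
  [set g | weighted_space alpha beta g /\
           (weighted_norm alpha beta g < r%:E)%E].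

Definition time_weighted_norm alpha beta (f : R -> R -> R -> R) : \bar R :=
  ereal_sup [set weighted_norm alpha beta (f t) | t in [set: R]].

Definition jointly_measurable (f : R -> R -> R -> R) : Prop :=
  measurable_fun [set: R * R * R] (fun p => f p.1.1 p.1.2 p.2).

Definition time_weighted_space alpha beta : set (R -> R -> R -> R) :=
  [set f | jointly_measurable f /\ (time_weighted_norm alpha beta f < +oo)%E].

Definition transport s (g : R -> R -> R) : R -> R -> R :=
  fun x v => g (x - s * v) v.

Definition grad_norm (h : R * R -> R) (p : R * R) : R :=
  Num.sqrt ((derive1 (fun a => h (a, p.2)) p.1) ^+ 2 +
            (derive1 (fun b => h (p.1, b)) p.2) ^+ 2).

(* The integral of [delta(h) F] over the plane. Where the gradient of [h]
   vanishes, the integrand is [F / 0 = 0]. *)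
Definition delta_integral (h F : R * R -> R) : R :=
  \int[hausdorff1_measure]_(p in [set p | h p = 0]) (F p / grad_norm h p).

(* [v5] is eliminated by [Sigma = 0]. *)
Definition sixth_velocity v v1 v2 v3 v4 : R := v + v1 + v2 - v3 - v4.

Definition resonance v v1 v2 v3 v4 v5 : R :=
  `|v| ^+ 2 + `|v1| ^+ 2 + `|v2| ^+ 2 - `|v3| ^+ 2 - `|v4| ^+ 2 - `|v5| ^+ 2.

Definition six_wave_product (f f1 f2 f3 f4 f5 : R) : R :=
  f3 * f4 * f5 * (f * f1 + f * f2 + f1 * f2)
  - f * f1 * f2 * (f3 * f4 + f3 * f5 + f4 * f5).

(* [w = (v1, v2)] and [p = (v3, v4)]. *)
Definition collision6 (f : R -> R -> R -> R) t x v : R :=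
  \int[(leb \x leb)%E]_(w in [set: R * R])
    delta_integral
      (fun p => resonance v w.1 w.2 p.1 p.2
                  (sixth_velocity v w.1 w.2 p.1 p.2))
      (fun p => six_wave_product (f t x v) (f t x w.1) (f t x w.2)
                  (f t x p.1) (f t x p.2)
                  (f t x (sixth_velocity v w.1 w.2 p.1 p.2))).

Definition oriented_integral (a b : R) (F : R -> R) : R :=
  if a <= b then \int[leb]_(s in `[a, b]) F s
  else - \int[leb]_(s in `[b, a]) F s.

Definition mild_solution alpha beta (f0 : R -> R -> R)
    (f : R -> R -> R -> R) : Prop :=
  [/\ weighted_space alpha beta f0,
      jointly_measurable f,
      time_weighted_space alpha beta (fun t => transport (- t) (f t)) &
      forall t x v, transport (- t) (f t) x v =
        f0 x v +
        oriented_integral 0 t (fun s => transport (- s) (collision6 f s) x v)].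

Definition time_infinity (plus : bool) : set_system R :=
  if plus then +oo else -oo.

Definition scatters alpha beta (plus : bool) (f : R -> R -> R -> R)
    (g : R -> R -> R) : Prop :=
  weighted_norm alpha beta (fun x v => transport (- t) (f t) x v - g x v)
    @[t --> time_infinity plus] --> 0%E.

Definition C1beta (C1 beta : R) : R :=
  2 `^ (- (1 / 2)) * C1 * (beta^-1 + 1).

End Kinetic.

(* Main.v *)
Require Import Defs.
From HB Require Import structures.
From mathcomp Require Import all_boot all_order all_algebra.
From mathcomp Require Import all_classical all_reals all_analysis.
From mathcomp Require Import measurable_realfun ring lra.

Set Implicit Arguments.
Unset Strict Implicit.
Unset Printing Implicit Defensive.

Import Order.TTheory GRing.Theory Num.Theory.
Import numFieldNormedType.Exports.

Local Open Scope classical_set_scope.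
Local Open Scope ring_scope.

(* In the moving frame g(t) = T^{-t} f(t), the equation reads g' = Q(g). On the
   resonant manifold the Gaussian weights satisfy e3 e4 e5 = e e1 e2, so Q is
   Lipschitz on balls of the weighted space, with a constant at time s that is a
   multiple of the Gaussian integral 1 / (alpha s^2 + beta) in (v1, v2). This
   rate is integrable over the whole line, and its integral is of order
   (alpha beta)^{-1/2}.

   For d = 1 the resonant set in the plane (v3, v4) is an ellipse along which
   |grad h| is proportional to the speed of its trigonometric parametrization, so
   the delta integral is a plain integral over the angle. The arc-length formula
   comes from comparing two measures on intervals whose values on a short
   interval differ by an error quadratic in its length.

   A contraction argument for g(t) = f_pm + (integral of Q(g) from pm infinity
   to t) gives a trajectory g, hence f0 = g(0). By Groenwall's lemma the distance of
   two trajectories at any time is controlled by that at any other time, which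
   gives uniqueness of the mild solution (time 0) and of f0 (times going to
   pm infinity). *)

(** * Borel sets and the Hausdorff measure *)

(** The delta integral is an integral against [hausdorff1] on its Caratheodory sigma-algebra, so it
    cannot be computed before the Borel sets are known to lie there. A separation argument for
    1-Lipschitz functions provides this. The change of variables is proved for nonnegative functions
    and passes to signed ones through positive and negative parts, because measurability of the
    collision operator has to be known before any bound makes its integrals converge. The decay rate
    comes from counting velocities: under free transport one Gaussian velocity integral decays like
    [1 / |s|], which is not integrable, and the two free velocities [v1], [v2] give [1 / s^2]. The
    velocities [v3], [v4] stay on a compact curve and contribute a constant factor. Smallness of
    [Rs] drives the contraction, on bounds of size [M = 2 Rs]. Uniqueness must compare mild
    solutions of unknown size; the Groenwall constant is finite for every [M] because the total rate
    is finite. Norms are handled as pointwise bounds by a multiple of the Gaussian, and limits are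
    taken point by point. *)

Section MetricOuterMeasure.
Context {R : realType} {T : Type} (mu : {outer_measure set T -> \bar R}).
Variable phi : T -> R.
Hypothesis mu_additive : forall (A B : set T) a b, a < b ->
  (forall p, A p -> phi p <= a) -> (forall p, B p -> b < phi p) ->
  (mu A + mu B <= mu (A `|` B))%E.
Local Open Scope ereal_scope.

(* The slabs [a + 1/(k+2) < phi <= a + 1/(k+1)] have finite total measure, as
   each one is at positive distance from all but one of the previous ones;
   hence the tail of the slabs near the level [a] is negligible. *)
Lemma caratheodory_superlevel a :
  caratheodory_measurable mu [set p | (a < phi p)%R].
Proof.
apply: le_caratheodory_measurable => X.
have [Xoo|Xoo] := eqVneq (mu X) +oo; first by rewrite Xoo leey.
have mu0 Y : 0 <= mu Y by exact: outer_measure_ge0.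
have Xfin (Y : set T) : Y `<=` X -> mu Y < +oo.
  by move=> YX; apply: (le_lt_trans (le_outer_measure mu _ _ YX)); rewrite ltey.
pose c (k : nat) : R := (a + k.+1%:R^-1)%R.
have c_anti k l : (k < l)%N -> (c l < c k)%R.
  by move=> kl; rewrite /c ltrD2l ltf_pV2 ?posrE// ltr_nat.
pose B n := X `&` [set p | (c n < phi p)%R].
pose D k := X `&` [set p | (c k.+1 < phi p <= c k)%R].
(* Two consecutive superlevel sets on the right treat slabs of both parities in one induction:
   [D n.+1] is at positive distance from [B n], and both lie in [B n.+2]. *)
have S_le n : \sum_(0 <= k < n) mu (D k.+1) <= mu (B n) + mu (B n.+1).
  elim: n => [|n IH]; first by rewrite big_geq// adde_ge0.
  rewrite big_nat_recr//=.
  apply: (le_trans (leeD2r _ IH)).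
  rewrite (addeC (mu (B n))) -addeA leeD2l// addeC.
  apply: (@le_trans _ _ (mu (D n.+1 `|` B n))).
    apply: (@mu_additive _ _ (c n.+1) (c n)); first exact: c_anti.
      by move=> p [_ /andP[]].
    by move=> p [].
  apply: le_outer_measure => p [[Xp /andP[? _]]|[Xp /= cp]]; split => //=.
  by apply: lt_trans cp; exact: c_anti.
have sumD : \sum_(0 <= k <oo) mu (D k) < +oo.
  rewrite nneseries_recl//.
  rewrite lte_add_pinfty//; first by apply: Xfin => p [].
  apply: (@le_lt_trans _ _ (mu X + mu X)); last first.
    by rewrite lte_add_pinfty//; exact: Xfin.
  rewrite -(@nneseries_addn _ (mu \o D) 1)//=.
  apply: lime_le; first by apply: is_cvg_nneseries => *; exact: outer_measure_ge0.
  apply: nearW => n.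
  under eq_bigr do rewrite addn1.
  apply: (le_trans (S_le n)).
  by apply: leeD; apply: le_outer_measure => p [].
have tailD : \sum_(n <= k <oo) mu (D k) @[n --> \oo] --> 0.
  by apply: nneseries_tail_cvg => // k _.
have split_X n : mu (X `&` [set p | (a < phi p)%R]) + mu (X `&` ~` [set p | (a < phi p)%R])
    <= mu X + \sum_(n <= k <oo) mu (D k).
  apply: (@le_trans _ _ ((mu (B n) + \sum_(n <= k <oo) mu (D k)) +
                         mu (X `&` ~` [set p | (a < phi p)%R]))).
    rewrite leeD2r//.
    apply: (@le_trans _ _ (mu (B n `|` \bigcup_(k in [set k | (n <= k)%N]) D k))).
      apply: le_outer_measure => p [Xp /= ap].
      have [m pm] : exists m, (c m < phi p)%R.
        exists (Num.truncn (phi p - a)^-1)%R.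
        rewrite /c -ltrBrDl invf_plt ?posrE ?subr_gt0//.
        exact: truncnS_gt.
      have : exists m, (c m < phi p)%R by exists m.
      move=> /ex_minnP[k ck kmin].
      have [kn|nk] := leqP k n.
        left; split => //=; move: kn; rewrite leq_eqVlt => /predU1P[<-//|kn].
        by apply: lt_trans ck; exact: c_anti.
      right; exists k.-1 => /=; first by rewrite -ltnS prednK// (leq_ltn_trans _ nk).
      have k0 : (0 < k)%N by rewrite (leq_ltn_trans _ nk).
      split => //=; rewrite prednK// ck /= leNgt; apply/negP => /kmin.
      by rewrite -ltnS prednK// ltnn.
    apply: (le_trans (outer_measureU2 mu _ _)); rewrite leeD2l//.
    rewrite ereal_series -[X in X <= _]/(mu _).
    rewrite bigcup_mkcond.
    apply: (le_trans (outer_measure_sigma_subadditive mu _)).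
    rewrite [leRHS]eseries_mkcond.
    apply: lee_nneseries => [k _ _//|k _].
    rewrite (_ : (k \in _) = (n <= k)%N); last by apply/idP/idP; rewrite inE.
    by case: ifPn; rewrite ?outer_measure0.
  rewrite addeAC leeD2r//.
  apply: (@le_trans _ _ (mu ((X `&` ~` [set p | (a < phi p)%R]) `|` B n))).
    rewrite addeC; apply: (@mu_additive _ _ a (c n)).
    - by rewrite /c ltrDl.
    - by move=> p [_ /= /negP]; rewrite -leNgt.
    - by move=> p [].
  by apply: le_outer_measure => p [[]|[]].
have : (mu X + \sum_(n <= k <oo) mu (D k)) @[n --> \oo] --> mu X + 0.
  by apply: cvgeD => //; [rewrite fin_num_adde_defl|exact: cvg_cst].
rewrite adde0 => /cvg_lim <-//.
apply: lime_ge; last by apply: nearW => n; exact: split_X.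
by apply: cvgP; apply: cvgeD; [| exact: cvg_cst | exact: tailD]; rewrite fin_num_adde_defl.
Qed.

End MetricOuterMeasure.

Local Notation edist := Defs.edist.

Section HausdorffBorel.
Context {R : realType}.
Implicit Types (p q : R * R) (A B C : set (R * R)).

Lemma edist_le_ediam C p q : C p -> C q -> ((edist p q)%:E <= ediam C)%E.
Proof.
move=> Cp Cq; rewrite /ediam le_max; apply/orP; right.
by apply: ereal_sup_ubound; exists (p, q).
Qed.

Lemma le_ediam A B : A `<=` B -> (ediam A <= ediam B)%E.
Proof.
move=> AB; rewrite /ediam ge_max le_max lexx/=.
rewrite le_max; apply/orP; right; apply/ereal_sup_le => _ [pq [Ap Aq] <-].
by exists pq => //; split; exact: AB.
Qed.

Lemma ediam_le A (r : R) : 0 <= r -> (forall p q, A p -> A q -> edist p q <= r) ->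
  (ediam A <= r%:E)%E.
Proof.
move=> r0 Ar; rewrite /ediam ge_max lee_fin r0/=.
by apply: ge_ereal_sup => _ [[p q] [Ap Aq] <-]; rewrite lee_fin; exact: Ar.
Qed.

Lemma edist_ge1 p q : `|p.1 - q.1| <= edist p q.
Proof. by rewrite -sqrtr_sqr ler_sqrt ?lerDl ?addr_ge0 ?sqr_ge0. Qed.

Lemma edist_ge2 p q : `|p.2 - q.2| <= edist p q.
Proof. by rewrite -sqrtr_sqr ler_sqrt ?lerDr ?addr_ge0 ?sqr_ge0. Qed.

Lemma hausdorff1_pre_anti d e A : d <= e ->
  (hausdorff1_pre e A <= hausdorff1_pre d A)%E.
Proof.
move=> de; apply/ereal_inf_le_tmp => _ [C [AC dC] <-]; exists C => //; split => // k.
by rewrite (le_trans (dC k))// lee_fin.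
Qed.

(** A set of diameter at most [d] cannot meet both [A] and [B], so a cover of the union splits into
    a cover of each with no set counted twice. *)
Lemma hausdorff1_pre_additive d A B :
  (forall p q, A p -> B q -> d < edist p q) ->
  (hausdorff1_pre d A + hausdorff1_pre d B <= hausdorff1_pre d (A `|` B))%E.
Proof.
move=> sepAB; apply: le_ereal_inf_tmp => _ [C [ABC dC] <-].
pose CA k := [set p | C k p /\ (exists2 q, C k q & A q)].
pose CB k := [set p | C k p /\ (exists2 q, C k q & B q)].
have CAC k : CA k `<=` C k by move=> p [].
have CBC k : CB k `<=` C k by move=> p [].
apply: (@le_trans _ _ (\sum_(k <oo) ediam (CA k) + \sum_(k <oo) ediam (CB k))%E).
  apply: leeD; apply: ereal_inf_lbound.
  - exists CA => //; split => [p Ap|k]; last exact: le_trans (le_ediam (@CAC k)) _.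
    by have [k _ Ck] := ABC p (or_introl Ap); exists k => //; split => //; exists p.
  - exists CB => //; split => [p Ap|k]; last exact: le_trans (le_ediam (@CBC k)) _.
    by have [k _ Ck] := ABC p (or_intror Ap); exists k => //; split => //; exists p.
rewrite -nneseriesD; do 2? by move=> *; exact: ediam_ge0.
apply: lee_nneseries => [k _ _|k _]; first by rewrite adde_ge0 ?ediam_ge0.
have [[p Cp Ap]|nA] := pselect (exists2 q, C k q & A q); last first.
  rewrite (_ : CA k = set0) ?ediam_set0 ?add0e ?le_ediam//.
  by apply/seteqP; split => // r [].
rewrite [X in (_ + ediam X)%E](_ : CB k = set0) ?ediam_set0 ?adde0 ?le_ediam//.
apply/seteqP; split => // r [_ [q Cq Bq]].
have := le_trans (edist_le_ediam Cp Cq) (dC k).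
by rewrite lee_fin leNgt sepAB.
Qed.

Lemma hausdorff1_additive (phi : R * R -> R) A B a b :
  (forall p q, `|phi p - phi q| <= edist p q) -> a < b ->
  (forall p, A p -> phi p <= a) -> (forall p, B p -> b < phi p) ->
  (hausdorff1 A + hausdorff1 B <= hausdorff1 (A `|` B))%E.
Proof.
move=> phi_lip ab Aa Bb.
have [->|Hoo] := eqVneq (hausdorff1 (A `|` B)) +oo%E; first by rewrite leey.
have Hfin C : C `<=` A `|` B -> hausdorff1 C \is a fin_num.
  move=> CAB; rewrite ge0_fin_numE ?hausdorff1_ge0//.
  by rewrite (le_lt_trans (hausdorff1_subset CAB)) ?ltey.
rewrite -leeBrDr ?Hfin//; apply: ge_ereal_sup => _ [d /= d0 <-].
rewrite leeBrDr ?Hfin//.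
have pfin : hausdorff1_pre d A \is a fin_num.
  rewrite ge0_fin_numE ?hausdorff1_pre_ge0// (@le_lt_trans _ _ (hausdorff1 A))//.
    by apply: ereal_sup_ubound; exists d.
  by rewrite ltey_eq Hfin.
rewrite addeC -leeBrDr//; apply: ge_ereal_sup => _ [e /= e0 <-].
rewrite leeBrDr// addeC.
(* A scale below the gap separates [A] from [B]; being also below [d] and [e], it dominates both
   premeasures. *)
pose m := Num.min (b - a) (Num.min d e) / 2.
have m0 : 0 < m by rewrite divr_gt0// !lt_min subr_gt0 ab d0 e0.
have [mba md me] : [/\ m < b - a, m <= d & m <= e].
  have : m < Num.min (b - a) (Num.min d e) by rewrite /m; move: m0; rewrite /m; lra.
  by rewrite !lt_min => /and3P[-> /ltW-> /ltW->].
apply: (@le_trans _ _ (hausdorff1_pre m (A `|` B))); last first.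
  by apply: ereal_sup_ubound; exists m.
apply: le_trans (hausdorff1_pre_additive _).
  by apply: leeD; exact: hausdorff1_pre_anti.
move=> p q Ap Bq; apply: (lt_le_trans mba); apply: le_trans (phi_lip _ _).
rewrite distrC (le_trans _ (ler_norm _))//.
by apply: lerB; [exact/ltW/Bb | exact: Aa].
Qed.

Notation H1type := (caratheodory_type (@hausdorff1_outer R)).

Lemma measurable_lipschitz_caratheodory (phi : R * R -> R) :
  (forall p q, `|phi p - phi q| <= edist p q) ->
  measurable_fun [set: H1type] (phi : H1type -> R).
Proof.
move=> phi_lip mT; apply: (measurability _ (measurable_realfun.RGenOInfty.measurableE R)) => //.
move=> /= _ [_ [x ->] <-]; apply: measurableI => //.
rewrite (_ : _ @^-1` _ = [set p | x < phi p]); last first.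
  by apply/seteqP; split => p /=; rewrite in_itv/= andbT.
apply: (@caratheodory_superlevel _ _ (@hausdorff1_outer R)) => A B a b ab Aa Bb.
exact: hausdorff1_additive phi_lip ab Aa Bb.
Qed.

(** The coordinates are 1-Lipschitz and generate the Borel sets of the plane. Hence every Borel
    function of the plane can be integrated against [hausdorff1_measure]. *)
Lemma measurable_id_caratheodory :
  measurable_fun [set: H1type] (id : H1type -> R * R).
Proof.
apply/measurable_fun_pairP; split.
  by apply: measurable_lipschitz_caratheodory; exact: edist_ge1.
by apply: measurable_lipschitz_caratheodory; exact: edist_ge2.
Qed.

End HausdorffBorel.

(** * Integrals along curves *)

Section DensityMeasure.
Context d (T : measurableType d) (R : realType).
Variable mu : {measure set T -> \bar R}.
Local Open Scope ereal_scope.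

(** The proofs about [w] are arguments so that the measure structure can be attached to the constant
    itself. *)
Definition density_measure (w : T -> R) of measurable_fun setT w &
  (forall x, 0 <= w x)%R := fun A : set T => \int[mu]_(x in A) (w x)%:E.

Variables (w : T -> R) (mw : measurable_fun setT w) (w0 : (forall x, 0 <= w x)%R).
Local Notation nu := (density_measure mw w0).

Let density_measure0 : nu set0 = 0.
Proof. by rewrite /density_measure integral_set0. Qed.

Let density_measure_ge0 A : 0 <= nu A.
Proof. by apply: integral_ge0 => x _; rewrite lee_fin. Qed.

Let density_measure_sigma_additive : semi_sigma_additive nu.
Proof.
move=> A mA tA mUA; rewrite /density_measure ge0_integral_bigcup//=.
- apply: is_cvg_ereal_nneg_natsum_cond => n _ _.
  exact: density_measure_ge0.
- by apply/measurable_EFinP; exact: measurable_funTS.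
- by move=> x _; rewrite lee_fin.
Qed.

HB.instance Definition _ := isMeasure.Build _ _ _
  nu density_measure0 density_measure_ge0 density_measure_sigma_additive.

End DensityMeasure.

Section IntegralDensity.
Context d (T : measurableType d) (R : realType).
Variables (mu nu : {measure set T -> \bar R}) (w : T -> R) (D : set T).
Hypotheses (mD : measurable D) (mw : measurable_fun D w).
Hypothesis w0 : (forall x, 0 <= w x)%R.
Local Open Scope ereal_scope.
Hypothesis nuE : forall A, measurable A -> A `<=` D ->
  nu A = \int[mu]_(x in A) (w x)%:E.

Import HBNNSimple.

(** Monotone convergence along simple functions reduces the formula to indicators, where it is
    [nuE]. Agreement is asked only inside [D], since for curves it is known only inside the
    parameter interval. *)
Lemma ge0_integral_density (f : T -> \bar R) : measurable_fun D f ->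
  (forall x, D x -> 0 <= f x) ->
  \int[nu]_(x in D) f x = \int[mu]_(x in D) (f x * (w x)%:E).
Proof.
move=> mf f0.
pose g := nnsfun_approx mD mf.
have gf x : D x -> EFin \o g ^~ x @ \oo --> f x by exact: cvg_nnsfun_approx.
transitivity (limn (fun n => \int[nu]_(x in D) (g n x)%:E)).
  rewrite -monotone_convergence//.
  - by apply: eq_integral => x /[!inE] Dx; apply/esym/cvg_lim => //; exact: gf.
  - by move=> n; apply/measurable_EFinP/measurable_funTS.
  - by move=> n x _; rewrite lee_fin.
  - by move=> x _ m n mn; rewrite lee_fin; exact/lefP/nd_nnsfun_approx.
transitivity (limn (fun n => \int[mu]_(x in D) ((g n x)%:E * (w x)%:E))); last first.
  rewrite -monotone_convergence//.
  - apply: eq_integral => x /[!inE] Dx; apply/cvg_lim => //.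
    by apply: cvgeZr => //; exact: gf.
  - move=> n; apply/emeasurable_funM; last exact/measurable_EFinP.
    by apply/measurable_EFinP/measurable_funTS.
  - by move=> n x _; rewrite mule_ge0 ?lee_fin.
  - move=> x _ m n mn; rewrite lee_wpmul2r ?lee_fin//.
    exact/lefP/nd_nnsfun_approx.
congr (limn _); apply/funext => n.
under eq_integral do rewrite fimfunE -fsumEFin//.
rewrite ge0_integral_fsum//; last 2 first.
- by move=> r; apply/measurable_EFinP/measurable_funTS/measurable_funM.
- by move=> r x _; rewrite nnfun_muleindic_ge0.
transitivity (\int[mu]_(x in D)
    \sum_(k \in range (g n)) ((k * \1_(g n @^-1` [set k]) x)%:E * (w x)%:E)).
  rewrite ge0_integral_fsum//; last 2 first.
  - move=> r; apply/emeasurable_funM; last exact/measurable_EFinP.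
    by apply/measurable_EFinP/measurable_funTS/measurable_funM.
  - by move=> r x _; rewrite mule_ge0 ?nnfun_muleindic_ge0 ?lee_fin//.
  apply: eq_fsbigr => r /[!inE] -[y _ gy].
  have r0 : (0 <= r)%R by rewrite -gy.
  have mr : measurable (g n @^-1` [set r]) by [].
  rewrite integralZl_indic_nnsfun// integral_indic// nuE//; last exact: measurableI.
  under [RHS]eq_integral do rewrite EFinM -muleA.
  rewrite ge0_integralZl//; last 2 first.
  - apply/emeasurable_funM; last exact/measurable_EFinP.
    by apply/measurable_EFinP/measurable_funTS.
  - by move=> x _; rewrite mule_ge0 ?lee_fin.
  congr (_ * _); rewrite setIC integral_mkcondr.
  apply: eq_integral => x _; rewrite patchE indicE.
  by case: ifPn => _; rewrite ?mul1e ?mul0e.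
apply: eq_integral => x _; rewrite -ge0_mule_fsuml; last first.
  by move=> r; rewrite nnfun_muleindic_ge0.
by rewrite fsumEFin// -fimfunE.
Qed.

End IntegralDensity.

(** * Sequences with geometric increments *)

Section Geometric.
Context {R : realType}.
Implicit Types (a b c : R) (u : nat -> R).

Lemma ler_geometric a b c : (forall n, a <= b + c / 2 ^+ n) -> a <= b.
Proof.
move=> ab; apply/ler_addgt0Pr => e e0.
apply: (le_trans (ab (Num.truncn (c / e)).+1)); rewrite lerD2l.
rewrite ler_pdivrMr ?exprn_gt0// -ler_pdivrMl// mulrC.
apply: ltW; apply: (lt_trans (truncnS_gt _)).
by rewrite -natrX ltr_nat ltn_expl.
Qed.

(** With [q n = c / 2 ^+ n], the sequences [u n - 2 * q n] and [u n + 2 * q n] are monotone in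
    opposite directions and every term of the first is below every term of the second. The supremum
    of the first is therefore a limit with its error bound built in. *)
Lemma geometric_limit u c : (forall n, `|u n.+1 - u n| <= c / 2 ^+ n) ->
  exists l, forall n, `|u n - l| <= 2 * c / 2 ^+ n.
Proof.
move=> uc; pose q n : R := c / 2 ^+ n.
have qS n : q n = 2 * q n.+1 by rewrite /q exprS; field; rewrite expf_neq0.
have qE n : 2 * c / 2 ^+ n = 2 * q n by rewrite /q mulrA.
have incr : {homo (fun n => u n - 2 * q n) : m n / (m <= n)%N >-> m <= n}.
  apply: homo_leq => [x|y x z|n]; [exact: lexx|exact: le_trans|].
  by have := uc n; rewrite -/(q n) ler_norml => /andP[? ?]; have := qS n; lra.
have decr : {homo (fun n => u n + 2 * q n) : m n / (m <= n)%N >-> n <= m}.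
  apply: homo_leq => [x|y x z yx zy|n]; [exact: lexx|exact: le_trans zy yx|].
  by have := uc n; rewrite -/(q n) ler_norml => /andP[? ?]; have := qS n; lra.
have q0 n : 0 <= q n by rewrite (le_trans _ (uc n)).
have ab m n : u m - 2 * q m <= u n + 2 * q n.
  have := incr _ _ (leq_maxl m n); have := decr _ _ (leq_maxr m n).
  by have := q0 (maxn m n); lra.
pose A := range (fun n => u n - 2 * q n).
have Aub : has_ubound A by exists (u 0%N + 2 * q 0%N) => _ [m _ <-].
exists (sup A) => n; rewrite qE ler_distlC; apply/andP; split.
  by apply: ub_le_sup => //; exists n.
by apply: ge_sup; [exists (u 0%N - 2 * q 0%N); exists 0%N|move=> _ [m _ <-]].
Qed.

Lemma cvg_geometric_dist u l c : (forall n, `|u n - l| <= c / 2 ^+ n) ->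
  u n @[n --> \oo] --> l.
Proof.
move=> ul; apply/cvgrPdist_le => e e0; near=> n.
rewrite distrC (le_trans (ul n))//.
rewrite ler_pdivrMr ?exprn_gt0// -ler_pdivrMl// mulrC.
apply: ltW; apply: (lt_trans (truncnS_gt _)).
apply: (@le_lt_trans _ _ n%:R); first by rewrite ler_nat; near: n; exact: nbhs_infty_ge.
by rewrite -natrX ltr_nat ltn_expl.
Unshelve. all: by end_near.
Qed.

End Geometric.

(** * Hausdorff measure of images of intervals *)

Section HausdorffLipschitz.
Context {R : realType}.
Implicit Types (g : R -> R * R) (t h L l : R).
Local Notation leb := (@lebesgue_measure R).

(** Cutting the interval into [N] equal pieces with [L * h / N <= d] gives an admissible cover of
    the image whose diameters add up to at most [L * h]. *)
Lemma hausdorff1_le_lipschitz g t h L : 0 <= h -> 0 <= L ->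
  (forall s s', s \in `]t, t + h] -> s' \in `]t, t + h] ->
    edist (g s) (g s') <= L * `|s - s'|) ->
  (hausdorff1 (g @` `]t, (t + h)%R]) <= (L * h)%:E)%E.
Proof.
move=> h0 L0 gL; apply: ge_ereal_sup => _ [d /= d0 <-].
pose N := (Num.truncn (L * h / d)).+1.
have N0 : (0 : R) < N%:R by rewrite ltr0n.
have LhN : L * (h / N%:R) <= d.
  rewrite mulrA ler_pdivrMr// -ler_pdivrMl// mulrC.
  exact/ltW/truncnS_gt.
pose C k := if (k < N)%N then
  g @` `]t + k%:R * (h / N%:R), t + k.+1%:R * (h / N%:R)] else set0.
have hN0 : 0 <= h / N%:R by rewrite divr_ge0// ltW.
have diamC k : (ediam (C k) <= (if (k < N)%N then L * (h / N%:R) else 0)%:E)%E.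
  rewrite /C; case: ifPn => kN; last by rewrite ediam_set0.
  apply: ediam_le => [|_ _ [s sk <-] [s' sk' <-]]; first by rewrite mulr_ge0.
  have sub : `]t + k%:R * (h / N%:R), t + k.+1%:R * (h / N%:R)] `<=` `]t, t + h].
    apply: subset_itv; rewrite bnd_simp; first by rewrite lerDl mulr_ge0.
    rewrite lerD2l mulrCA ler_piMr// ler_pdivrMr// mul1r ler_nat//.
  apply: (le_trans (gL _ _ (sub _ sk) (sub _ sk'))).
  rewrite ler_wpM2l//; move: sk sk'; rewrite /= !in_itv/= -natr1.
  move=> /andP[? ?] /andP[? ?]; rewrite ler_distl; lra.
apply: (@le_trans _ _ (\sum_(k <oo) ediam (C k))%E).
  apply: ereal_inf_lbound; exists C => //; split => [_ [s st <-]|k]; last first.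
    apply: (le_trans (diamC k)); rewrite lee_fin; case: ifPn => // _; exact: ltW.
  have [h00|hpos] := eqVneq h 0.
    by move: st; rewrite /= in_itv/= h00 addr0 => /andP[/lt_le_trans/[apply]]; rewrite ltxx.
  have {}hpos : 0 < h / N%:R by rewrite divr_gt0// lt_neqAle eq_sym hpos.
  move: st; rewrite /= in_itv/= => /andP[ts sth].
  have x0 : 0 < (s - t) / (h / N%:R) by rewrite divr_gt0// subr_gt0.
  have : exists k : nat, (s - t) / (h / N%:R) <= k.+1%:R.
    exists (Num.truncn ((s - t) / (h / N%:R))); exact/ltW/truncnS_gt.
  move=> /ex_minnP[k sk kmin]; exists k => //.
  have ks : k%:R < (s - t) / (h / N%:R).
    case: k sk kmin => // k sk kmin; rewrite ltNge; apply/negP => /kmin.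
    by rewrite ltnn.
  have kN : (k < N)%N.
    rewrite -(ltr_nat R) (lt_le_trans ks)// ler_pdivrMr// mulrC divfK ?gt_eqF//.
    by rewrite lerBlDl.
  rewrite /C kN; exists s => //=; rewrite in_itv/=; apply/andP; split.
    by rewrite -ltrBrDl -ltr_pdivlMr.
  by rewrite -lerBlDl -ler_pdivrMr.
apply: (@le_trans _ _ (\sum_(k <oo)
    (if (k < N)%N then L * (h / N%:R) else 0)%:E)%E).
  by apply: lee_nneseries => k *; [exact: ediam_ge0|exact: diamC].
have LhN0 : 0 <= L * (h / N%:R) by rewrite mulr_ge0.
rewrite (nneseries_split 0 N); last by move=> k _; rewrite lee_fin; case: ifP.
rewrite add0n [X in (_ + X)%E]eseries0 ?adde0; last first.
  by move=> k Nk _; rewrite ltnNge Nk.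
rewrite big_mkord (eq_bigr (fun=> (L * (h / N%:R))%:E)); last first.
  by move=> i _; rewrite ltn_ord.
rewrite sumEFin sumr_const card_ord -[X in X%:E]mulr_natr -!mulrA mulVf ?mulr1//.
by rewrite gt_eqF.
Qed.

(** Any cover of the image pulls back to a cover of the interval by sets of diameter at most
    [ediam (C k) / l]; countable subadditivity of Lebesgue measure then bounds [h]. *)
Lemma hausdorff1_ge_lipschitz g t h l : 0 <= h -> 0 < l ->
  (forall s s', s \in `]t, t + h] -> s' \in `]t, t + h] ->
    l * `|s - s'| <= edist (g s) (g s')) ->
  ((l * h)%:E <= hausdorff1 (g @` `]t, (t + h)%R]))%E.
Proof.
move=> h0 l0 gl; apply: (@le_trans _ _ (hausdorff1_pre 1 (g @` `]t, (t + h)%R]%classic)));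
  last first.
  by apply: ereal_sup_ubound; exists 1 => //=.
apply: le_ereal_inf_tmp => _ [C [gC C1] <-].
pose B k := [set s | s \in `]t, t + h] /\ C k (g s)].
(* The preimages are arbitrary sets, so each is replaced by its closed hull, which is measurable and
   no wider. *)
pose J k : set R := if B k != set0 then `[inf (B k), sup (B k)]%classic else set0.
have Cfin k : ediam (C k) \is a fin_num.
  by rewrite ge0_fin_numE ?ediam_ge0// (le_lt_trans (C1 k))// ltry.
have lbB k : has_lbound (B k).
  by exists t => s [/=]; rewrite in_itv/= => /andP[/ltW].
have ubB k : has_ubound (B k).
  by exists (t + h) => s [/=]; rewrite in_itv/= => /andP[].
have JC k : (leb (J k) <= (l^-1)%:E * ediam (C k))%E.
  rewrite /J; case: ifPn => [/set0P B0|_]; last first.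
    by rewrite measure0 mule_ge0 ?ediam_ge0// lee_fin invr_ge0 ltW.
  rewrite lebesgue_measure_itv/=; case: ifPn => _; last first.
    by rewrite mule_ge0 ?ediam_ge0// lee_fin invr_ge0 ltW.
  rewrite -(fineK (Cfin k)) -EFinB -EFinM lee_fin.
  set r := l^-1 * _.
  have Br s s' : B k s -> B k s' -> s <= s' + r.
    move=> [sI Cs] [sI' Cs'].
    have := le_trans (gl _ _ sI sI') _; rewrite -lerBlDl /r.
    move=> /(_ (fine (ediam (C k)))) H.
    rewrite mulrC ler_pdivlMr// mulrC; apply: le_trans (H _).
      by rewrite ler_wpM2l ?(ltW l0)// ler_norm.
    by rewrite -lee_fin fineK//; exact: edist_le_ediam.
  rewrite lerBlDr; apply: ge_sup => // s Bs; rewrite addrC -lerBlDr.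
  by apply: lb_le_inf => // s' Bs'; rewrite lerBlDr; exact: Br.
have : ((h)%:E <= \sum_(k <oo) leb (J k))%E.
  rewrite [X in (X <= _)%E](_ : _ = leb `]t, (t + h)]%classic); last first.
    rewrite lebesgue_measure_itv/= lte_fin ltrDl; case: ltP => h'.
      by rewrite -EFinB addrAC subrr add0r.
    by congr EFin; apply/eqP; rewrite eq_le h0 h'.
  apply: measure_sigma_subadditive => //=.
    by move=> k; rewrite /J; case: ifPn => // _; exact: measurable_itv.
  move=> s st; have [|k _ Ck] := gC (g s); first by exists s.
  have Bs : B k s by split.
  exists k => //; rewrite /J ifT; last by apply/set0P; exists s.
  by rewrite /= in_itv/=; apply/andP; split; [exact: ge_inf|exact: ub_le_sup].
move=> hJ; rewrite EFinM.
apply: (@le_trans _ _ (l%:E * \sum_(k <oo) leb (J k))%E).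
  by rewrite lee_wpmul2l// lee_fin ltW.
rewrite -nneseriesZl//.
apply: lee_nneseries => [k _ _|k _]; first by rewrite mule_ge0// lee_fin ltW.
apply: (le_trans (lee_wpmul2l _ (JC k))); first by rewrite lee_fin ltW.
by rewrite muleA -EFinM divff ?gt_eqF// mul1e.
Qed.

(* Halving the interval halves the quadratic error bound. *)
Lemma additive_quadratic_eq0 (F : R -> R -> R) (a b C : R) :
  (forall x y z, a <= x -> x <= y -> y <= z -> z <= b -> F x z = F x y + F y z) ->
  (forall x y, a <= x -> x <= y -> y <= b -> `|F x y| <= C * (y - x) ^+ 2) ->
  forall x y, a <= x -> x <= y -> y <= b -> F x y = 0.
Proof.
move=> Fadd FC.
have FCn n : forall x y, a <= x -> x <= y -> y <= b ->
    `|F x y| * 2 ^+ n <= C * (y - x) ^+ 2.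
  elim: n => [|n IH] x y ax xy yb; first by rewrite mulr1; exact: FC.
  pose m := (x + y) / 2.
  have [xm my] : x <= m /\ m <= y by rewrite /m; split; lra.
  rewrite (Fadd x m y)//.
  have H1 := IH x m ax xm (le_trans my yb).
  have H2 := IH m y (le_trans ax xm) my yb.
  apply: (@le_trans _ _ ((`|F x m| + `|F m y|) * 2 ^+ n.+1)).
    by rewrite ler_wpM2r// ?ler_normD// exprn_ge0.
  rewrite exprSr mulrA mulrDl.
  have -> : C * (y - x) ^+ 2 = (C * (m - x) ^+ 2 + C * (y - m) ^+ 2) * 2.
    by rewrite /m; field.
  by rewrite ler_wpM2r// lerD.
move=> x y ax xy yb; apply/eqP; rewrite -normr_le0.
apply: (@ler_geometric _ _ _ (C * (y - x) ^+ 2)) => n.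
by rewrite add0r ler_pdivlMr ?exprn_gt0//; exact: FCn.
Qed.

End HausdorffLipschitz.

Section MeasureUniqueInterval.
Context {R : realType}.
Variables (m1 m2 : {measure set (measurableTypeR R) -> \bar R}) (a b : R).

(** The restrictions to []a, b]] are compared: the uniqueness theorem wants a generating family that
    is stable under intersection and exhausts the line, while agreement is known only inside []a,
    b]]. *)
Lemma measure_unique_itv :
  (forall x y, a <= x -> x <= y -> y <= b -> m1 `]x, y]%classic = m2 `]x, y]%classic) ->
  (m1 `]a, b]%classic < +oo)%E ->
  forall A, measurable A -> A `<=` `]a, b] -> m1 A = m2 A.
Proof.
move=> m12 m1oo A mA Aab.
have mab : measurable (`]a, b]%classic : set (measurableTypeR R)) by exact: measurable_itv.
suff : mrestr m1 mab A = mrestr m2 mab A by rewrite /mrestr setIidl.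
have itvI (x y : R) : `]x, y] `&` `]a, b] = `]Num.max x a, Num.min y b]%classic.
  apply/seteqP; split => z /=; rewrite !in_itv/= gt_max le_min.
    by move=> [/andP[-> ->] /andP[-> ->]].
  by move=> /andP[/andP[-> ->] /andP[-> ->]].
apply: (@measure_unique _ R (measurableTypeR R) (@ocitv R)
  (fun n => `](- n%:R), n%:R]%classic) _ _ _ _ (mrestr m1 mab) (mrestr m2 mab)) => //.
- exact: ocitvI.
- by move=> n; exact: is_ocitv.
- apply/seteqP; split => // x _; exists (Num.truncn `|x|).+1 => //=.
  rewrite in_itv/=; have := truncnS_gt `|x|; rewrite ltr_norml => /andP[-> /ltW//].
- move=> _ [[x y] _ <-] /=; rewrite /mrestr itvI.
  have [xy|xy] := leP (Num.max x a) (Num.min y b); last first.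
    by rewrite set_itv_ge ?measure0// bnd_simp -leNgt ltW.
  by apply: m12 => //; rewrite ?le_max ?ge_min ?lexx ?orbT.
- move=> n; apply: (le_lt_trans _ m1oo); apply: le_measure; rewrite ?inE//.
  exact: measurableI.
Qed.

End MeasureUniqueInterval.

Section CurveIntegral.
Context {R : realType}.
Variables (g : R -> R * R) (w : R -> R) (ang : R * R -> R) (a b C : R).
Hypotheses (C0 : 0 <= C) (w0 : forall t, 0 <= w t).
Hypothesis mw : measurable_fun [set: R] w.
Hypothesis mg : measurable_fun [set: R] g.
Hypothesis mang : measurable_fun [set: R * R] ang.
Hypothesis gK : forall t, t \in `]a, b] -> ang (g t) = t.
Hypothesis angK : forall p, ang p \in `]a, b] -> g (ang p) = p.
Hypothesis w_lip : forall s t, `|w s - w t| <= C * `|s - t|.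
(** This says that [w] is the speed of [g], without derivatives: on an interval of length [h] the
    curve is bi-Lipschitz with constants [w t - C * h] and [w t + C * h]. *)
Hypothesis speed : forall t h s s' : R, 0 <= h -> s \in `]t, t + h] -> s' \in `]t, t + h] ->
  `|edist (g s) (g s') - w t * `|s - s'| | <= C * h * `|s - s'|.
Local Notation leb := (@lebesgue_measure R).
Local Notation H1type := (caratheodory_type (@hausdorff1_outer R)).

Lemma hausdorff1_curve_bounds x y : x <= y ->
  (((w x - C * (y - x)) * (y - x))%:E <= hausdorff1 (g @` `]x, y]) <=
   ((w x + C * (y - x)) * (y - x))%:E)%E.
Proof.
move=> xy; have h0 : 0 <= y - x by rewrite subr_ge0.
have -> : `]x, y]%classic = `]x, (x + (y - x))]%classic by rewrite addrC subrK.
apply/andP; split; last first.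
  apply: hausdorff1_le_lipschitz => //; first by rewrite addr_ge0// mulr_ge0.
  move=> s s' sI s'I; have := speed h0 sI s'I.
  by rewrite ler_distl mulrDl => /andP[].
have [wC|wC] := leP (w x - C * (y - x)) 0.
  by rewrite (le_trans _ (hausdorff1_ge0 _))// lee_fin mulr_le0_ge0.
apply: hausdorff1_ge_lipschitz => // s s' sI s'I; have := speed h0 sI s'I.
by rewrite ler_distl mulrBl => /andP[].
Qed.

Lemma integral_speed_bounds x y : x <= y ->
  (((w x - C * (y - x)) * (y - x))%:E <= \int[leb]_(t in `]x, y]) (w t)%:E <=
   ((w x + C * (y - x)) * (y - x))%:E)%E.
Proof.
move=> xy.
have wxt t : x < t <= y -> w x - C * (y - x) <= w t <= w x + C * (y - x).
  move=> /andP[xt ty]; rewrite -ler_distl (le_trans (w_lip _ _))//.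
  by rewrite ler_wpM2l// ger0_norm ?lerD2r// subr_ge0 ltW.
have Ixy c : (\int[leb]_(t in `]x, y]) c%:E = (c * (y - x))%:E)%E.
  rewrite integral_cst//= lebesgue_measure_itv/= lte_fin EFinM.
  move: xy; rewrite le_eqVlt => /predU1P[->|->]; last by rewrite EFinB.
  by rewrite ltxx subrr.
rewrite -!Ixy; apply/andP; split.
  have [wC|wC] := leP (w x - C * (y - x)) 0.
    rewrite (@le_trans _ _ 0%E)//; last by apply: integral_ge0 => t _; rewrite lee_fin.
    by rewrite Ixy lee_fin mulr_le0_ge0// subr_ge0.
  apply: ge0_le_integral => //=.
  - by move=> t _; rewrite lee_fin ltW.
  - exact/measurable_EFinP/measurable_funTS.
  - by move=> t; rewrite in_itv/= => /wxt /andP[].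
apply: ge0_le_integral => //=.
- by move=> t _; rewrite lee_fin.
- exact/measurable_EFinP/measurable_funTS.
- by move=> t; rewrite in_itv/= => /wxt /andP[].
Qed.

Lemma ge0_integral_hausdorff1_curve (f : R * R -> \bar R) :
  measurable_fun [set: R * R] f -> (forall p, 0 <= f p)%E ->
  (\int[hausdorff1_measure]_(p in ang @^-1` `]a, b]) f p =
   \int[leb]_(t in `]a, b]) (f (g t) * (w t)%:E))%E.
Proof.
move=> mf f0.
have mangH : measurable_fun [set: H1type] (ang : H1type -> measurableTypeR R).
  exact: measurableT_comp mang measurable_id_caratheodory.
(* Pushing [hausdorff1] forward by the inverse [ang] of the parametrization turns the arc-length
   formula into an equality of two Borel measures on the line. *)
pose m1 : {measure set (measurableTypeR R) -> \bar R} :=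
  measure_function_pushforward__canonical__measure_function_Measure
    hausdorff1_measure mangH.
pose m2 : {measure set (measurableTypeR R) -> \bar R} := density_measure leb mw w0.
have m1E x y : a <= x -> y <= b -> m1 `]x, y]%classic = hausdorff1 (g @` `]x, y]).
  move=> ax yb; rewrite /m1/= /pushforward; congr hausdorff1.
  have xyab : `]x, y] `<=` `]a, b] by apply: subset_itv; rewrite bnd_simp.
  apply/seteqP; split => [p /= pxy|_ [t txy <-]/=].
    by exists (ang p) => //; apply: angK; exact: xyab.
  by rewrite gK//; exact: xyab.
have m1_fin x y : a <= x -> y <= b -> x <= y -> m1 `]x, y]%classic \is a fin_num.
  move=> ax yb xy; rewrite ge0_fin_numE// m1E//.
  by have /andP[_ /le_lt_trans->//] := hausdorff1_curve_bounds xy; rewrite ltry.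
have m2_fin x y : x <= y -> m2 `]x, y]%classic \is a fin_num.
  move=> xy; rewrite ge0_fin_numE//.
  by have /andP[_ /le_lt_trans->//] := integral_speed_bounds xy; rewrite ltry.
have addm (m : {measure set (measurableTypeR R) -> \bar R}) (x y z : R) :
    x <= y -> y <= z -> (m `]x, z]%classic = m `]x, y]%classic + m `]y, z]%classic)%E.
  move=> xy yz; rewrite (@itv_bndbnd_setU _ _ _ (BRight y)) ?bnd_simp//.
  rewrite measureU//=; try exact: measurable_itv.
  apply/seteqP; split => // t [/=]; rewrite !in_itv/= => /andP[_ ty] /andP[yt _].
  by move: (lt_le_trans yt ty); rewrite ltxx.
have m12 x y : a <= x -> x <= y -> y <= b -> m1 `]x, y]%classic = m2 `]x, y]%classic.
  pose F x y := fine (m1 `]x, y]%classic) - fine (m2 `]x, y]%classic).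
  move=> ax xy yb; apply/eqP.
  rewrite -(fineK (m1_fin _ _ ax yb xy)) -(fineK (m2_fin _ _ xy)) eqe -subr_eq0.
  apply/eqP; apply: (@additive_quadratic_eq0 _ F a b (2 * C)) => //.
    move=> r s t ar rs st tb; rewrite /F (addm m1 r s t)// (addm m2 r s t)//.
    have sb := le_trans st tb; have a_s := le_trans ar rs.
    rewrite (fineD (m1_fin r s ar sb rs) (m1_fin s t a_s tb st)).
    by rewrite (fineD (m2_fin r s rs) (m2_fin s t st)) opprD addrACA.
  move=> r s ar rs sb; rewrite /F.
  have B1 := hausdorff1_curve_bounds rs; rewrite -m1E// in B1.
  have B2 : (((w r - C * (s - r)) * (s - r))%:E <= m2 `]r, s]%classic <=
      ((w r + C * (s - r)) * (s - r))%:E)%E := integral_speed_bounds rs.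
  move: B1 B2 (m1_fin r s ar sb rs) (m2_fin r s rs).
  case: (m1 `]r, s]%classic) => [u| |] //; case: (m2 `]r, s]%classic) => [v| |] //.
  rewrite !lee_fin /= => /andP[? ?] /andP[? ?] _ _.
  by rewrite ler_norml; apply/andP; split; lra.
have m1ab : (m1 `]a, b]%classic < +oo)%E.
  have [ab|ab] := leP a b; first by rewrite -ge0_fin_numE// m1_fin.
  by rewrite set_itv_ge ?measure0// bnd_simp -leNgt ltW.
have mab : measurable (`]a, b]%classic : set (measurableTypeR R)) by exact: measurable_itv.
have mfg : measurable_fun (`]a, b]%classic : set (measurableTypeR R)) (f \o g).
  apply: (@measurable_funS _ _ (measurableTypeR R) _ setT) => //.
  exact: measurableT_comp mf mg.
rewrite -(@ge0_integral_density _ _ _ leb m1 w `]a, b]%classic) //.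
- rewrite [RHS](@ge0_integral_pushforward _ _ _ _ _ _ mangH hausdorff1_measure _ (f \o g))//.
  + by apply: eq_integral => p; rewrite inE/= => pab; rewrite angK.
  + by move=> t _ /=.
- by apply: (@measurable_funS _ _ (measurableTypeR R) _ setT).
- by move=> A mA Aab; exact: (measure_unique_itv m12 m1ab).
Qed.

End CurveIntegral.

(** * The resonant ellipse *)

Section Circle.
Context {R : realType}.
Implicit Types (x y t : R).

Lemma measurable_funV d (T : measurableType d) (D : set T) (f : T -> R) :
  measurable_fun D f -> measurable_fun D (fun z => (f z)^-1).
Proof.
move=> mf; rewrite (_ : (fun z => _) = (fun z => f z * (f z ^+ 2) `^ (-1))).
  apply: measurable_funM => //.
  apply: (@measurableT_comp _ _ _ _ _ _ (fun r : R => r `^ (-1))).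
    exact: measurable_powR.
  exact: measurable_funX.
apply/funext => z; rewrite powR_inv1 ?sqr_ge0//.
have [->|fz0] := eqVneq (f z) 0; first by rewrite invr0 mul0r.
by field.
Qed.

(** The half-angle formula [tan (t / 2) = sin t / (1 + cos t)] gives the angle by a single
    expression on the circle without the point [(-1, 0)], with no distinction of quadrants. *)
Definition circle_angle x y : R := if x == -1 then pi else 2 * atan (y / (1 + x)).

Lemma circle_angle_bounds x y : - pi < circle_angle x y <= pi.
Proof.
rewrite /circle_angle; case: ifPn => _.
  by rewrite lexx andbT (lt_trans _ (pi_gt0 R))// oppr_lt0 pi_gt0.
have := atan_gtNpi2 (y / (1 + x)); have := atan_ltpi2 (y / (1 + x)).
by move=> ? ?; apply/andP; split; lra.
Qed.

Lemma circle_angleK t : - pi < t <= pi -> circle_angle (cos t) (sin t) = t.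
Proof.
move=> /andP[tpi]; rewrite le_eqVlt => /predU1P[->|pit].
  by rewrite /circle_angle cospi eqxx.
pose u := t / 2.
have tu : t = u *+ 2 by rewrite /u -mulr_natr divfK.
have cu : 0 < cos u.
  by apply: cos_gt0_pihalf; rewrite /u; apply/andP; split; lra.
have c1 : 1 + cos t = 2 * cos u ^+ 2 by rewrite tu cos_mulr2n; ring.
have c10 : 1 + cos t != 0 by rewrite c1 mulf_neq0// expf_neq0// gt_eqF.
rewrite /circle_angle ifF; last first.
  by apply/negbTE; apply: contra_neq c10 => ->; rewrite subrr.
rewrite c1 {1}tu sin_mulr2n (_ : _ / _ = tan u); last first.
  by rewrite /tan; field; rewrite gt_eqF.
rewrite tanK; first by rewrite /u mulrC divfK.
by rewrite in_itv/= /u; apply/andP; split; lra.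
Qed.

Lemma circle_angle_cos_sin x y : x ^+ 2 + y ^+ 2 = 1 ->
  cos (circle_angle x y) = x /\ sin (circle_angle x y) = y.
Proof.
move=> xy1; rewrite /circle_angle; case: ifPn => [/eqP x1|x1].
  move: xy1; rewrite x1 sqrrN expr1n => /eqP.
  rewrite addrC -[X in _ == X]add0r (inj_eq (addIr _)) sqrf_eq0 => /eqP ->.
  by rewrite cospi sinpi.
have x10 : 1 + x != 0.
  by apply: contra_neq x1 => /eqP; rewrite addrC addr_eq0 => /eqP.
set u := y / (1 + x); set c := cos (atan u).
have c2 : c ^+ 2 = (1 + u ^+ 2)^-1.
  by rewrite /c cos_atan exprVn sqr_sqrtr// addr_ge0// sqr_ge0.
have u2 : 1 + u ^+ 2 = 2 / (1 + x).
  rewrite /u expr_div_n (_ : y ^+ 2 = (1 - x) * (1 + x)); first by field.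
  by have -> : y ^+ 2 = 1 - x ^+ 2 by [rewrite -xy1; ring]; ring.
have c2x : c ^+ 2 = (1 + x) / 2 by rewrite c2 u2 invf_div.
have c0 : c != 0.
  by rewrite -sqrf_eq0 c2x mulf_neq0.
have su : sin (atan u) = u * c by rewrite -[in LHS](divfK c0 (sin _)) -/(tan _) atanK.
rewrite (mulrC 2) mulr_natr cos_mulr2n sin_mulr2n su -/c; split.
  by rewrite c2x -mulr_natr divfK//; ring.
by rewrite mulrCA -expr2 c2x -mulr_natr mulrA divfK// /u divfK.
Qed.

Lemma measurable_circle_angle d (T : measurableType d) (f g : T -> R) :
  measurable_fun setT f -> measurable_fun setT g ->
  measurable_fun setT (fun z => circle_angle (f z) (g z)).
Proof.
move=> mf mg; apply: measurable_fun_ifT => //.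
  by apply: measurable_fun_eqr.
apply: measurable_funM => //; apply: (@measurableT_comp _ _ _ _ _ _ (@atan R)).
  by apply: continuous_measurable_fun => z; exact: continuous_atan.
by apply: measurable_funM => //; apply: measurable_funV; exact: measurable_funD.
Qed.

End Circle.

Section PlaneNorm.
Context {R : realType}.
Implicit Types (x y : R).

Lemma sqrt_sqr_add_le x y u v :
  Num.sqrt ((x + u) ^+ 2 + (y + v) ^+ 2) <=
  Num.sqrt (x ^+ 2 + y ^+ 2) + (`|u| + `|v|) :> R.
Proof.
set r := Num.sqrt (x ^+ 2 + y ^+ 2).
have r0 : 0 <= r by exact: sqrtr_ge0.
have r2 : r ^+ 2 = x ^+ 2 + y ^+ 2 by rewrite sqr_sqrtr// addr_ge0// sqr_ge0.
have xr : `|x| <= r by rewrite -sqrtr_sqr ler_sqrt ?lerDl ?addr_ge0 ?sqr_ge0.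
have yr : `|y| <= r by rewrite -sqrtr_sqr ler_sqrt ?lerDr ?addr_ge0 ?sqr_ge0.
rewrite -[leRHS]ger0_norm ?addr_ge0// -sqrtr_sqr ler_sqrt ?sqr_ge0//.
have xu : x * u <= r * `|u|.
  by rewrite (le_trans (ler_norm _))// normrM ler_wpM2r.
have yv : y * v <= r * `|v|.
  by rewrite (le_trans (ler_norm _))// normrM ler_wpM2r.
have uv : 0 <= `|u| * `|v| by rewrite mulr_ge0.
have := real_normK (num_real u); have := real_normK (num_real v).
move: (`|u|) (`|v|) xu yv uv => u' v' xu yv uv v2 u2.
by rewrite !sqrrD r2 u2 v2; lra.
Qed.

Lemma sqrt_sqr_add_dist x y x' y' :
  `|Num.sqrt (x ^+ 2 + y ^+ 2) - Num.sqrt (x' ^+ 2 + y' ^+ 2)| <=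
  `|x - x'| + `|y - y'|.
Proof.
rewrite ler_distl; apply/andP; split.
  rewrite lerBlDr; have := sqrt_sqr_add_le x y (x' - x) (y' - y).
  by rewrite !subrKC (distrC x') (distrC y').
by have := sqrt_sqr_add_le x' y' (x - x') (y - y'); rewrite !subrKC.
Qed.

End PlaneNorm.

Section TrigLipschitz.
Context {R : realType}.
Implicit Types (A B s t h : R).

Lemma is_derive_trig A B t :
  is_derive t 1 (fun t => A * cos t + B * sin t) (B * cos t - A * sin t).
Proof. by apply: is_derive_eq; rewrite /GRing.scale/=; ring. Qed.

Lemma trig_mean_value A B s t : exists2 c : R, Num.min s t <= c <= Num.max s t &
  (A * cos s + B * sin s) - (A * cos t + B * sin t) =
  (B * cos c - A * sin c) * (s - t).
Proof.
wlog st : s t / t <= s.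
  move=> H; case/orP: (le_total t s) => [/H//|/H[c]]; rewrite minC maxC => cst E.
  by exists c => //; rewrite -opprB E; ring.
have dF x : x \in `]t, s[ ->
    is_derive x 1 (fun t => A * cos t + B * sin t) (B * cos x - A * sin x).
  by move=> _; exact: is_derive_trig.
have cF : {within `[t, s], continuous (fun t => A * cos t + B * sin t)}.
  apply: derivable_within_continuous => x _.
  by have [] := is_derive_trig A B x.
have [c cst E] := MVT_segment st dF cF.
by exists c => //; move: cst; rewrite in_itv/= (min_idPr st) (max_idPl st).
Qed.

Lemma trig_lipschitz A B s t :
  `|(A * cos s + B * sin s) - (A * cos t + B * sin t)| <= (`|A| + `|B|) * `|s - t|.
Proof.
have [c _ ->] := trig_mean_value A B s t.
rewrite normrM ler_wpM2r// (le_trans (ler_normB _ _))// !normrM addrC.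
apply: lerD; rewrite ler_piMr// ler_norml.
  by rewrite sin_geN1 sin_le1.
by rewrite cos_geN1 cos_le1.
Qed.

Variables (c1 c2 A1 B1 A2 B2 : R).
Let g t := (c1 + (A1 * cos t + B1 * sin t), c2 + (A2 * cos t + B2 * sin t)).
Let w t : R := Num.sqrt ((B1 * cos t - A1 * sin t) ^+ 2 + (B2 * cos t - A2 * sin t) ^+ 2).
Let C : R := `|A1| + `|B1| + (`|A2| + `|B2|).

Lemma ellipse_speed_lipschitz s t : `|w s - w t| <= C * `|s - t|.
Proof.
apply: (le_trans (sqrt_sqr_add_dist _ _ _ _)); rewrite mulrDl.
apply: lerD.
  have := trig_lipschitz B1 (- A1) s t.
  by rewrite !mulNr normrN (addrC `|B1|).
have := trig_lipschitz B2 (- A2) s t.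
by rewrite !mulNr normrN (addrC `|B2|).
Qed.

(** By the mean value theorem each coordinate of the chord is [s - s'] times a derivative at an
    intermediate point, which is within [(|A| + |B|) * h] of the derivative at [t]. *)
Lemma ellipse_chord t h s s' : 0 <= h -> s \in `]t, t + h] -> s' \in `]t, t + h] ->
  `|edist (g s) (g s') - w t * `|s - s'| | <= C * h * `|s - s'|.
Proof.
move=> h0; rewrite !in_itv/= => sI s'I; rewrite /edist /=.
have bnd A B : exists2 e, `|e| <= (`|A| + `|B|) * h &
    A * cos s + B * sin s - (A * cos s' + B * sin s') =
    (B * cos t - A * sin t + e) * (s - s').
  have [c cI E] := trig_mean_value A B s s'.
  exists (B * cos c - A * sin c - (B * cos t - A * sin t)); last by rewrite E; ring.
  have := trig_lipschitz B (- A) c t; rewrite !mulNr normrN (addrC `|B|) => H.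
  apply: (le_trans H); rewrite ler_wpM2l// ?addr_ge0// ler_norml.
  move: cI sI s'I; rewrite ge_min le_max => /andP[/orP cI /orP cI'].
  move=> /andP[? ?] /andP[? ?]; apply/andP; split.
    by case: cI => ?; lra.
  by case: cI' => ?; lra.
have [e1 e1C E1] := bnd A1 B1; have [e2 e2C E2] := bnd A2 B2.
have cancel (c x y : R) : c + x - (c + y) = x - y by ring.
rewrite !cancel E1 E2.
rewrite !exprMn -mulrDl sqrtrM ?addr_ge0 ?sqr_ge0// sqrtr_sqr -mulrBl.
rewrite normrM normr_id ler_wpM2r// (le_trans (sqrt_sqr_add_dist _ _ _ _))//.
by rewrite !(addrC _ e1) !(addrC _ e2) !addrK /C mulrDl lerD.
Qed.

End TrigLipschitz.

Section ResonantEllipse.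
Context {R : realType}.
Implicit Types (v t c k : R) (w p : R * R).
Local Notation leb := (@lebesgue_measure R).

Definition resonance_fun v w p : R :=
  resonance v w.1 w.2 p.1 p.2 (sixth_velocity v w.1 w.2 p.1 p.2).

Definition resonant_center v w : R := (v + w.1 + w.2) / 3.

(** Its square is the constant term of the resonance function, up to the factor 2, once the plane is
    centered at [resonant_center]. It vanishes exactly when [v = w.1 = w.2], and then the resonant
    set is a point. *)
Definition resonant_radius v w : R := Num.sqrt
  (((v - w.1) ^+ 2 + (v - w.2) ^+ 2 + (w.1 - w.2) ^+ 2) / 6).

(* The coordinates are kept in the form [A cos t + B sin t] of [ellipse_chord]. *)
Definition ellipse_point c k t : R * R :=
  (c + (k * cos t + - (k / Num.sqrt 3) * sin t),
   c + (0 * cos t + 2 * k / Num.sqrt 3 * sin t)).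

Definition resonant_point v w t : R * R :=
  ellipse_point (resonant_center v w) (resonant_radius v w) t.

Definition ellipse_speed k t : R := Num.sqrt
  ((- (k / Num.sqrt 3) * cos t - k * sin t) ^+ 2 +
   (2 * k / Num.sqrt 3 * cos t - 0 * sin t) ^+ 2).

Lemma resonance_funE v w p : let a := p.1 - resonant_center v w in
  let b := p.2 - resonant_center v w in
  resonance_fun v w p =
  2 * (resonant_radius v w ^+ 2 - (a ^+ 2 + a * b + b ^+ 2)).
Proof.
rewrite /resonance_fun /resonance /sixth_velocity /resonant_radius /resonant_center.
rewrite !real_normK ?num_real//= sqr_sqrtr; last first.
  by rewrite divr_ge0// !addr_ge0// sqr_ge0.
by field.
Qed.

Lemma derive1_quadratic (A B C x : R) :
  derive1 (fun x : R => A + B * x + C * x ^+ 2) x = B + 2 * C * x.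
Proof.
rewrite derive1E; apply: derive_val.
by apply: is_derive_eq; rewrite /GRing.scale/=; ring.
Qed.

Lemma resonance_grad_norm v w p :
  let a := p.1 - resonant_center v w in let b := p.2 - resonant_center v w in
  grad_norm (resonance_fun v w) p =
  Num.sqrt ((4 * a + 2 * b) ^+ 2 + (4 * b + 2 * a) ^+ 2).
Proof.
move=> a b; rewrite /grad_norm; set c := resonant_center v w in a b *.
set K := resonant_radius v w.
have -> : (fun x => resonance_fun v w (x, p.2)) = (fun x =>
    (2 * (K ^+ 2 - c ^+ 2 - b ^+ 2) + 2 * c * b) + (4 * c - 2 * b) * x + (- 2) * x ^+ 2).
  by apply/funext => x; rewrite resonance_funE/= -/c -/K -/b; ring.
have -> : (fun x => resonance_fun v w (p.1, x)) = (fun x =>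
    (2 * (K ^+ 2 - c ^+ 2 - a ^+ 2) + 2 * c * a) + (4 * c - 2 * a) * x + (- 2) * x ^+ 2).
  by apply/funext => x; rewrite resonance_funE/= -/c -/K -/a; ring.
by rewrite !derive1_quadratic; congr Num.sqrt; rewrite /a /b; ring.
Qed.

Let q3 : (Num.sqrt 3 : R) ^+ 2 = 3. Proof. by rewrite sqr_sqrtr. Qed.
Let q0 : (Num.sqrt 3 : R) != 0. Proof. by rewrite sqrtr_eq0 -ltNge. Qed.

(** In centered coordinates [a ^+ 2 + a * b + b ^+ 2 = (a + b / 2) ^+ 2 + 3 / 4 * b ^+ 2], and the
    parametrization is [a + b / 2 = k * cos t], [Num.sqrt 3 / 2 * b = k * sin t]. *)
Lemma resonance_fun_point v w t : resonance_fun v w (resonant_point v w t) = 0.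
Proof.
rewrite resonance_funE /resonant_point /ellipse_point/=.
set c := resonant_center v w; set k := resonant_radius v w; set q := Num.sqrt 3.
have := cos2Dsin2 t; set C := cos t; set S := sin t => CS.
rewrite !(addrC c) !addrK mul0r add0r.
transitivity (2 * (k ^+ 2 - k ^+ 2 * (C ^+ 2 + S ^+ 2 * (3 / q ^+ 2)))).
  by field.
by rewrite q3 divff// mulr1 CS mulr1 subrr mulr0.
Qed.

(** The gradient turned by a right angle is the Hamiltonian field of the resonance function. As that
    function is quadratic, its flow runs through the ellipse as a harmonic motion in the angle, with
    frequency the square root of the Hessian determinant 12. *)
Lemma resonance_grad_norm_point v w t :
  grad_norm (resonance_fun v w) (resonant_point v w t) =
  2 * Num.sqrt 3 * ellipse_speed (resonant_radius v w) t.
Proof.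
rewrite resonance_grad_norm /resonant_point /ellipse_point /ellipse_speed/=.
set c := resonant_center v w; set k := resonant_radius v w.
rewrite !(addrC c) !addrK !mul0r add0r subr0.
set C := cos t; set S := sin t.
have -> : 2 * Num.sqrt 3 = Num.sqrt 12 :> R.
  have -> : (12 : R) = 2 ^+ 2 * 3 by ring.
  by rewrite sqrtrM ?sqr_ge0// sqrtr_sqr ger0_norm.
rewrite -sqrtrM//; congr Num.sqrt.
have r2 : (Num.sqrt 3 : R)^-1 ^+ 2 = 3^-1 by rewrite exprVn q3.
move: (Num.sqrt 3)^-1 r2 => r r2.
transitivity (20 * k ^+ 2 * C ^+ 2 + 24 * r * k ^+ 2 * C * S + 36 * r ^+ 2 * k ^+ 2 * S ^+ 2).
  by ring.
transitivity (12 * k ^+ 2 * (5 * r ^+ 2 * C ^+ 2 + 2 * r * C * S + S ^+ 2)); last by ring.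
by rewrite r2; field.
Qed.

Lemma measurable_cos d (T : measurableType d) (f : T -> R) :
  measurable_fun setT f -> measurable_fun setT (fun z => cos (f z)).
Proof.
move=> mf; apply: (@measurableT_comp _ _ _ _ _ _ (@cos R)) => //.
by apply: continuous_measurable_fun; exact: continuous_cos.
Qed.

Lemma measurable_sin d (T : measurableType d) (f : T -> R) :
  measurable_fun setT f -> measurable_fun setT (fun z => sin (f z)).
Proof.
move=> mf; apply: (@measurableT_comp _ _ _ _ _ _ (@sin R)) => //.
by apply: continuous_measurable_fun; exact: continuous_sin.
Qed.

Lemma measurable_sqrt d (T : measurableType d) (f : T -> R) :
  measurable_fun setT f -> measurable_fun setT (fun z => Num.sqrt (f z)).
Proof.
move=> mf; apply: (@measurableT_comp _ _ _ _ _ _ (@Num.sqrt R)) => //.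
by apply: continuous_measurable_fun; exact: sqrt_continuous.
Qed.

Lemma measurable_ellipse_point d (T : measurableType d) (c k t : T -> R) :
  measurable_fun setT c -> measurable_fun setT k -> measurable_fun setT t ->
  measurable_fun setT (fun z => ellipse_point (c z) (k z) (t z)).
Proof.
move=> mc mk mt; have mC := measurable_cos mt; have mS := measurable_sin mt.
apply: measurable_fun_pair; apply: measurable_funD => //; apply: measurable_funD => //.
- exact: measurable_funM.
- by apply: measurable_funM => //; apply: measurable_funN; exact: measurable_funM.
- exact: measurable_funM.
- by apply: measurable_funM => //; do 2 apply: measurable_funM => //.
Qed.

Lemma measurable_resonance_fun v w : measurable_fun [set: R * R] (resonance_fun v w).
Proof.
rewrite (_ : resonance_fun v w = fun p => 2 * (resonant_radius v w ^+ 2 -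
  ((p.1 - resonant_center v w) ^+ 2 + (p.1 - resonant_center v w) *
   (p.2 - resonant_center v w) + (p.2 - resonant_center v w) ^+ 2))); last first.
  by apply/funext => p; rewrite resonance_funE.
have m1 : measurable_fun [set: R * R] (fun p => p.1 - resonant_center v w).
  exact: measurable_funB.
have m2 : measurable_fun [set: R * R] (fun p => p.2 - resonant_center v w).
  exact: measurable_funB.
apply: measurable_funM => //; apply: measurable_funB => //.
by apply: measurable_funD; [apply: measurable_funD; [exact: measurable_funX|
  exact: measurable_funM]|exact: measurable_funX].
Qed.

(* Off the ellipse the value is outside [`]- pi, pi]]. *)
Definition resonant_angle v w p : R :=
  let a := p.1 - resonant_center v w in let b := p.2 - resonant_center v w in
  if resonance_fun v w p == 0 then
    circle_angle ((a + b / 2) / resonant_radius v w)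
      (Num.sqrt 3 / 2 * b / resonant_radius v w)
  else 2 * pi.

Lemma measurable_resonant_angle v w : measurable_fun [set: R * R] (resonant_angle v w).
Proof.
have m1 : measurable_fun [set: R * R] (fun p => p.1 - resonant_center v w).
  exact: measurable_funB.
have m2 : measurable_fun [set: R * R] (fun p => p.2 - resonant_center v w).
  exact: measurable_funB.
apply: measurable_fun_ifT => //.
  by apply: measurable_fun_eqr => //; exact: measurable_resonance_fun.
apply: measurable_circle_angle; apply: measurable_funM => //.
  by apply: measurable_funD => //; exact: measurable_funM.
exact: measurable_funM.
Qed.

Lemma resonant_angle_itv v w p :
  (resonant_angle v w p \in `]- pi, pi]) = (resonance_fun v w p == 0).
Proof.
rewrite in_itv/= /resonant_angle; case: ifPn => _.
  exact: circle_angle_bounds.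
apply/negbTE; rewrite negb_and -!ltNge; apply/orP; right.
by have := pi_gt0 R; lra.
Qed.

Lemma resonant_angleK v w t : resonant_radius v w != 0 -> t \in `]- pi, pi] ->
  resonant_angle v w (resonant_point v w t) = t.
Proof.
move=> k0; rewrite in_itv/= => tpi.
rewrite /resonant_angle resonance_fun_point eqxx -[RHS](circle_angleK tpi).
rewrite /resonant_point /ellipse_point/=.
by congr circle_angle; field; rewrite k0 q0.
Qed.

Lemma resonant_pointK v w p : resonant_radius v w != 0 ->
  resonant_angle v w p \in `]- pi, pi] -> resonant_point v w (resonant_angle v w p) = p.
Proof.
move=> k0; rewrite resonant_angle_itv => /eqP hp.
rewrite /resonant_angle hp eqxx /resonant_point /ellipse_point.
move: hp; rewrite resonance_funE.
move: (resonant_center v w) (resonant_radius v w) k0 => c k k0 hp.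
set x := _ / k; set y := _ / k.
have xy1 : x ^+ 2 + y ^+ 2 = 1.
  have -> : x ^+ 2 + y ^+ 2 = ((p.1 - c + (p.2 - c) / 2) ^+ 2 +
      (Num.sqrt 3) ^+ 2 / 4 * (p.2 - c) ^+ 2) / k ^+ 2 by rewrite /x /y; field.
  by rewrite q3; apply: (mulIf (expf_neq0 2 k0)); rewrite mul1r divfK ?expf_neq0//; lra.
have [-> ->] := circle_angle_cos_sin xy1.
rewrite /x /y; case: p {hp x y xy1} => p1 p2 /=.
by congr pair; field; rewrite k0 q0.
Qed.

Lemma ellipse_speed_gt0 k t : k != 0 -> 0 < ellipse_speed k t.
Proof.
move=> k0; rewrite sqrtr_gt0 mul0r subr0 lt_neqAle addr_ge0 ?sqr_ge0// andbT eq_sym.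
rewrite paddr_eq0 ?sqr_ge0// !sqrf_eq0 negb_and.
have [c0|c0] := eqVneq (cos t) 0.
  apply/orP; left; rewrite c0 mulr0 sub0r oppr_eq0 mulf_neq0//.
  apply/eqP => s0; have := cos2Dsin2 t; rewrite c0 s0 expr0n/= addr0 => /eqP.
  by rewrite eq_sym oner_eq0.
by apply/orP; right; rewrite !mulf_neq0// invr_eq0.
Qed.

Lemma ge0_integral_resonant v w (f : R * R -> \bar R) : resonant_radius v w != 0 ->
  measurable_fun [set: R * R] f -> (forall p, 0 <= f p)%E ->
  (\int[hausdorff1_measure]_(p in [set p | resonance_fun v w p = 0%R]) f p =
   \int[leb]_(t in `](- pi)%R, pi])
     (f (resonant_point v w t) * (ellipse_speed (resonant_radius v w) t)%:E))%E.
Proof.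
move=> k0 mf f0; set k := resonant_radius v w.
have -> : [set p | resonance_fun v w p = 0] = resonant_angle v w @^-1` `]- pi, pi].
  by apply/seteqP; split => p /=; rewrite resonant_angle_itv => /eqP.
apply: (@ge0_integral_hausdorff1_curve _ (resonant_point v w) (ellipse_speed k)
   (resonant_angle v w) (- pi) pi
   (`|k| + `|- (k / Num.sqrt 3)| + (`|0| + `|2 * k / Num.sqrt 3|))) => //.
- by rewrite !addr_ge0.
- by move=> t; exact: sqrtr_ge0.
- apply: measurable_sqrt; apply: measurable_funD; apply: measurable_funX;
  apply: measurable_funB; apply: measurable_funM => //;
  by [exact: measurable_cos|exact: measurable_sin].
- by apply: measurable_ellipse_point.
- exact: measurable_resonant_angle.
- by move=> t; exact: resonant_angleK.
- by move=> p; exact: resonant_pointK.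
- by move=> s t; exact: ellipse_speed_lipschitz.
- by move=> t h s s'; exact: ellipse_chord.
Qed.

(** The speed of the parametrization cancels the gradient. For radius zero the resonant set is the
    center alone, the gradient vanishes there and the integrand is [F / 0 = 0], whence the zero
    branch. *)
Lemma delta_integral_resonance v w (F : R * R -> R) :
  measurable_fun [set: R * R] F ->
  delta_integral (resonance_fun v w) F =
  \int[leb]_(t in `]- pi, pi])
    (if resonant_radius v w == 0 then 0
     else F (resonant_point v w t) / (2 * Num.sqrt 3)).
Proof.
move=> mF; rewrite /delta_integral; have [k0|k0] := eqVneq (resonant_radius v w) 0.
  rewrite [RHS](_ : _ = 0); last by rewrite /Rintegral integral0_eq.
  rewrite /Rintegral integral0_eq// => p /=; rewrite resonance_funE k0.
  rewrite resonance_grad_norm.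
  set a := p.1 - _; set b := p.2 - _ => ab.
  have [-> ->] : a = 0 /\ b = 0.
    have : (a + b / 2) ^+ 2 + 3 / 4 * b ^+ 2 == 0 by apply/eqP; lra.
    rewrite paddr_eq0; [move=> /andP[]|exact: sqr_ge0|by rewrite mulr_ge0// sqr_ge0].
    rewrite sqrf_eq0 mulf_eq0 sqrf_eq0 => /eqP ab0 /orP[|/eqP b0].
      by move/eqP; lra.
    by split => //; move: ab0; rewrite b0 mul0r addr0.
  by rewrite !mulr0 addr0 expr0n/= addr0 sqrtr0 invr0 mulr0.
rewrite /Rintegral; congr fine.
set f := fun p => (F p / grad_norm (resonance_fun v w) p)%:E.
have mgrad : measurable_fun [set: R * R] (grad_norm (resonance_fun v w)).
  have m1 : measurable_fun [set: R * R] (fun p => p.1 - resonant_center v w).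
    exact: measurable_funB.
  have m2 : measurable_fun [set: R * R] (fun p => p.2 - resonant_center v w).
    exact: measurable_funB.
  rewrite (funext (resonance_grad_norm v w)).
  by apply: measurable_sqrt; apply: measurable_funD; apply: measurable_funX;
    apply: measurable_funD; apply: measurable_funM.
have mf : measurable_fun [set: R * R] f.
  by apply/measurable_EFinP; apply: measurable_funM => //; exact: measurable_funV.
have fE t : (F (resonant_point v w t) / (2 * Num.sqrt 3))%:E =
    (f (resonant_point v w t) * (ellipse_speed (resonant_radius v w) t)%:E)%E.
  have s0 := ellipse_speed_gt0 t k0.
  rewrite /f -EFinM resonance_grad_norm_point; congr EFin; field.
  by rewrite q0 gt_eqF.
have s_ge0 t : (0 <= (ellipse_speed (resonant_radius v w) t)%:E)%E.
  by rewrite lee_fin sqrtr_ge0.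
(* No integrability of [F] is assumed, so the positive and the negative part are transformed
   separately; the speed is nonnegative and commutes with both. *)
rewrite integralE [RHS]integralE; congr (_ - _)%E.
  rewrite ge0_integral_resonant//; last exact: measurable_funepos.
  by apply: eq_integral => t _; rewrite !funeposE fE maxe_pMl// mul0e.
rewrite ge0_integral_resonant//; last exact: measurable_funeneg.
by apply: eq_integral => t _; rewrite !funenegE fE maxe_pMl// mul0e mulNe.
Qed.

End ResonantEllipse.

(** * Estimates on the collision operator *)

Section Close.
Context {R : realType}.
Implicit Types (a b A B d e : R).

(** Size and distance travel together, so one calculus of products, sums and integrals yields the
    bound and the Lipschitz estimate of the collision operator at once. *)
Definition close_within A d a a' := [/\ `|a| <= A, `|a'| <= A & `|a - a'| <= d].

Lemma close_withinM A d a a' B e b b' :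
  close_within A d a a' -> close_within B e b b' ->
  close_within (A * B) (d * B + A * e) (a * b) (a' * b').
Proof.
move=> [aA a'A aa'] [bB b'B bb']; split; rewrite ?normrM ?ler_pM//.
have -> : a * b - a' * b' = (a - a') * b + a' * (b - b') by ring.
by rewrite (le_trans (ler_normD _ _))// !normrM lerD// ler_pM.
Qed.

Lemma close_withinD A d a a' B e b b' :
  close_within A d a a' -> close_within B e b b' ->
  close_within (A + B) (d + e) (a + b) (a' + b').
Proof.
move=> [aA a'A aa'] [bB b'B bb'].
by split; rewrite ?opprD 1?addrACA (le_trans (ler_normD _ _))// lerD.
Qed.

Lemma close_withinN A d a a' :
  close_within A d a a' -> close_within A d (- a) (- a').
Proof. by move=> [aA a'A aa']; split; rewrite -?opprD normrN. Qed.

Lemma close_withinB A d a a' B e b b' :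
  close_within A d a a' -> close_within B e b b' ->
  close_within (A + B) (d + e) (a - b) (a' - b').
Proof. by move=> aa' /close_withinN bb'; exact: close_withinD. Qed.

Lemma close_within_le A d a a' B e : A <= B -> d <= e ->
  close_within A d a a' -> close_within B e a a'.
Proof.
by move=> AB de [aA a'A aa']; split; [exact: le_trans AB|exact: le_trans AB|exact: le_trans de].
Qed.

Lemma close_withinMl c A d a a' : 0 <= c ->
  close_within A d a a' -> close_within (c * A) (c * d) (c * a) (c * a').
Proof.
move=> c0 [aA a'A aa']; by split; rewrite -?mulrBr normrM (ger0_norm c0) ler_wpM2l.
Qed.

Lemma close_withinMr c A d a a' : 0 <= c ->
  close_within A d a a' -> close_within (A * c) (d * c) (a * c) (a' * c).
Proof. by rewrite !(mulrC _ c); exact: close_withinMl. Qed.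

Lemma close_within0 A d : 0 <= A -> 0 <= d -> close_within A d 0 0.
Proof. by move=> A0 d0; split; rewrite ?subrr ?normr0. Qed.

End Close.

Section RintegralClose.
Context d (T : measurableType d) (R : realType) (mu : {measure set T -> \bar R}).
Variables (D : set T) (mD : measurable D).

Lemma le_normr_integrable (f g : T -> R) : measurable_fun D f ->
  mu.-integrable D (EFin \o g) -> (forall x, D x -> `|f x| <= g x) ->
  mu.-integrable D (EFin \o f).
Proof.
move=> mf ig fg; apply: le_integrable ig => //; first exact/measurable_EFinP.
by move=> x Dx /=; rewrite lee_fin (le_trans (fg x Dx))// ler_norm.
Qed.

Lemma integrable_scale (c : R) (f : T -> R) : mu.-integrable D (EFin \o f) ->
  mu.-integrable D (EFin \o (fun x => c * f x)).
Proof.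
by move=> /(integrableZl mD c); apply: eq_integrable => // x _; rewrite EFinM.
Qed.

Lemma close_within_Rintegral (F F' A e : T -> R) :
  measurable_fun D F -> measurable_fun D F' ->
  mu.-integrable D (EFin \o A) -> mu.-integrable D (EFin \o e) ->
  (forall x, D x -> close_within (A x) (e x) (F x) (F' x)) ->
  close_within (\int[mu]_(x in D) A x) (\int[mu]_(x in D) e x)
    (\int[mu]_(x in D) F x) (\int[mu]_(x in D) F' x).
Proof.
move=> mF mF' iA ie FF'.
have iF : mu.-integrable D (EFin \o F).
  by apply: (le_normr_integrable mF iA) => x /FF'[].
have iF' : mu.-integrable D (EFin \o F').
  by apply: (le_normr_integrable mF' iA) => x /FF'[].
have bound (f g : T -> R) : mu.-integrable D (EFin \o f) -> mu.-integrable D (EFin \o g) ->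
    (forall x, D x -> `|f x| <= g x) ->
    `|\int[mu]_(x in D) f x| <= \int[mu]_(x in D) g x.
  move=> jf jg fg; apply: (le_trans (le_normr_Rintegral mD jf)).
  apply: le_Rintegral => //.
  apply: (le_normr_integrable _ jg) => [|x Dx]; last by rewrite normr_id fg.
  apply: measurableT_comp => //; apply/measurable_EFinP; exact: measurable_int jf.
split; rewrite -?RintegralB//; apply: bound => //; try by move=> x /FF'[].
exact: (integrableB mD iF iF').
Qed.

End RintegralClose.

Section RintegralParam.
Context d1 d2 (X : measurableType d1) (Y : measurableType d2) (R : realType).
Variables (mu : {sigma_finite_measure set Y -> \bar R}) (D : set Y) (mD : measurable D).

(** [Rintegral] is [fine] of a difference of two nonnegative integrals, so Tonelli's theorem applies
    to each and covers the parameters at which the integral diverges. *)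
Lemma measurable_Rintegral_param (F : X * Y -> R) :
  measurable_fun [set: X * Y] F ->
  measurable_fun [set: X] (fun x => \int[mu]_(y in D) F (x, y)).
Proof.
move=> mF; pose G (z : X * Y) : R := F z * \1_D z.2.
have mG : measurable_fun [set: X * Y] (EFin \o G).
  apply/measurable_EFinP; apply: measurable_funM => //.
  apply: (@measurableT_comp _ _ _ _ _ _ (\1_D : Y -> R)) => //.
have -> : (fun x => \int[mu]_(y in D) F (x, y)) = fun x => fine
    (\int[mu]_y (EFin \o G)^\+ (x, y) - \int[mu]_y (EFin \o G)^\- (x, y))%E.
  apply/funext => x; rewrite /Rintegral integral_mkcond integralE.
  congr fine; congr (_ - _)%E; apply: eq_integral => y _.
    rewrite !funeposE patchE /G/= indicE.
    by case: ifPn => _; rewrite ?mulr1 ?mulr0.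
  rewrite !funenegE patchE /G/= indicE.
  by case: ifPn => _; rewrite ?mulr1 ?mulr0.
apply: measurableT_comp; first exact: fine_measurable.
have mp : measurable_fun [set: X] (fubini_F mu (EFin \o G)^\+%E).
  by apply: measurable_fun_fubini_tonelli_F => //; exact: measurable_funepos.
have mn : measurable_fun [set: X] (fubini_F mu (EFin \o G)^\-%E).
  by apply: measurable_fun_fubini_tonelli_F => //; exact: measurable_funeneg.
exact: emeasurable_funB mp mn.
Qed.

End RintegralParam.

Section GaussianIntegral.
Context {R : realType}.
Implicit Types (a m alpha beta x v s : R).
Local Notation leb := (@lebesgue_measure R).

Lemma integral_gaussian a m : 0 < a ->
  (\int[leb]_u (expR (- (a * (u - m) ^+ 2)))%:E = (Num.sqrt (pi / a))%:E)%E.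
Proof.
(* The standard deviation of the normal density proportional to the integrand:
   [1 / (2 * sg ^+ 2) = a]. *)
move=> a0; pose sg : R := Num.sqrt (2 * a)^-1.
have sg2 : sg ^+ 2 = (2 * a)^-1 by rewrite sqr_sqrtr// invr_ge0 mulr_ge0// ltW.
have sg0 : sg != 0 by rewrite -sqrf_eq0 sg2 invr_eq0 mulf_neq0// gt_eqF.
have pk0 := normal_peak_gt0 sg0.
have E u : expR (- (a * (u - m) ^+ 2)) = (normal_peak sg)^-1 * normal_pdf m sg u.
  rewrite normal_pdfE// mulrA mulVf ?gt_eqF// mul1r /normal_fun; congr expR.
  by rewrite sg2 -mulr_natr; field; rewrite gt_eqF.
under eq_integral do rewrite E EFinM.
rewrite integralZl//=; last exact: integrable_normal_pdf.
rewrite integral_normal_pdf mule1 /normal_peak invrK; congr (Num.sqrt _)%:E.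
by rewrite sg2 -mulr_natr; field; rewrite gt_eqF.
Qed.

(** Completing the square in [u] leaves a nonnegative constant in the exponent, which is dropped.
    The coefficient of [u ^+ 2] grows with [s] since, under free transport, localization in space
    becomes localization in velocity; this is the source of decay in time. *)
Lemma integral_gaussian_le alpha beta x s v : 0 < alpha -> 0 < beta ->
  (\int[leb]_u (expR (- (alpha * (x + s * (v - u)) ^+ 2 + beta * u ^+ 2)))%:E <=
   (Num.sqrt (pi / (alpha * s ^+ 2 + beta)))%:E)%E.
Proof.
move=> al0 be0; set a := alpha * s ^+ 2 + beta.
have a0 : 0 < a by rewrite ltr_wpDl// mulr_ge0 ?sqr_ge0// ltW.
rewrite -(integral_gaussian (alpha * s * (x + s * v) / a) a0).
apply: ge0_le_integral => //=.
- apply/measurable_EFinP; apply: measurableT_comp => //.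
  apply: measurable_funN; apply: measurable_funD; apply: measurable_funM => //.
    apply: measurable_funX; apply: measurable_funD => //; apply: measurable_funM => //.
    exact: measurable_funB.
- apply/measurable_EFinP; apply: measurableT_comp => //.
  apply: measurable_funN; apply: measurable_funM => //.
  by apply: measurable_funX; exact: measurable_funB.
- move=> u _; rewrite lee_fin ler_expR lerN2.
  have -> : alpha * (x + s * (v - u)) ^+ 2 + beta * u ^+ 2 =
      a * (u - alpha * s * (x + s * v) / a) ^+ 2 +
      alpha * beta * (x + s * v) ^+ 2 / a.
    rewrite /a; field.
    by rewrite gt_eqF.
  rewrite lerDl; apply: divr_ge0; last exact: ltW.
  by apply: mulr_ge0; [rewrite mulr_ge0 ?ltW|exact: sqr_ge0].
Qed.

End GaussianIntegral.

Section SixWaveProduct.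
Context {R : realType}.
Implicit Types (M D e : R).

Lemma close_within_cubic M D e1 e2 e3 (f1 f2 f3 g1 g2 g3 : R) :
  close_within (M * e1) (D * e1) f1 g1 -> close_within (M * e2) (D * e2) f2 g2 ->
  close_within (M * e3) (D * e3) f3 g3 ->
  close_within (M ^+ 3 * (e1 * e2 * e3)) (3 * M ^+ 2 * D * (e1 * e2 * e3))
    (f1 * f2 * f3) (g1 * g2 * g3).
Proof.
move=> h1 h2 h3; apply: close_within_le (close_withinM (close_withinM h1 h2) h3).
  by lra.
by lra.
Qed.

Lemma close_within_elem_sym2 M D (f1 f2 f3 g1 g2 g3 : R) :
  close_within M D f1 g1 -> close_within M D f2 g2 -> close_within M D f3 g3 ->
  close_within (3 * M ^+ 2) (6 * M * D)
    (f1 * f2 + f1 * f3 + f2 * f3) (g1 * g2 + g1 * g3 + g2 * g3).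
Proof.
move=> h1 h2 h3; apply: close_within_le
  (close_withinD (close_withinD (close_withinM h1 h2) (close_withinM h1 h3))
     (close_withinM h2 h3)).
  by lra.
by lra.
Qed.

(** In both terms the cubic factor keeps its weights, and conservation makes the two products of
    weights equal; in the quadratic factor the weights are bounded by 1. The constants are
    [6 = 2 * 3] and [30 = 2 * (3 * 3 + 6)], from gain and loss together. *)
Lemma close_within_six_wave_product M D e e1 e2 e3 e4 e5
    (f f1 f2 f3 f4 f5 g g1 g2 g3 g4 g5 : R) : 0 <= M -> 0 <= D ->
  e <= 1 -> e1 <= 1 -> e2 <= 1 -> e3 <= 1 -> e4 <= 1 -> e5 <= 1 ->
  e3 * e4 * e5 = e * e1 * e2 ->
  close_within (M * e) (D * e) f g -> close_within (M * e1) (D * e1) f1 g1 ->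
  close_within (M * e2) (D * e2) f2 g2 -> close_within (M * e3) (D * e3) f3 g3 ->
  close_within (M * e4) (D * e4) f4 g4 -> close_within (M * e5) (D * e5) f5 g5 ->
  close_within (6 * M ^+ 5 * (e * e1 * e2)) (30 * M ^+ 4 * D * (e * e1 * e2))
    (six_wave_product f f1 f2 f3 f4 f5) (six_wave_product g g1 g2 g3 g4 g5).
Proof.
move=> M0 D0 le le1 le2 le3 le4 le5 E h h1 h2 h3 h4 h5.
have flat (a : R) (u u' : R) : a <= 1 -> close_within (M * a) (D * a) u u' ->
    close_within M D u u'.
  by move=> a1; apply: close_within_le; rewrite ler_piMr.
have gain := close_withinM (close_within_cubic h3 h4 h5)
  (close_within_elem_sym2 (flat _ _ _ le h) (flat _ _ _ le1 h1) (flat _ _ _ le2 h2)).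
have loss := close_withinM (close_within_cubic h h1 h2)
  (close_within_elem_sym2 (flat _ _ _ le3 h3) (flat _ _ _ le4 h4) (flat _ _ _ le5 h5)).
apply: close_within_le (close_withinB gain loss).
  by rewrite E; lra.
by rewrite E; lra.
Qed.

End SixWaveProduct.

Section Collision.
Context {R : realType}.
Implicit Types (alpha beta M D t x v s u : R) (w : R * R) (f : R -> R -> R -> R).
Local Notation leb := (@lebesgue_measure R).

Definition gauss_weight alpha beta x v : R :=
  expR (- (alpha * x ^+ 2 + beta * v ^+ 2)).

Lemma gauss_weight_gt0 alpha beta x v : 0 < gauss_weight alpha beta x v.
Proof. exact: expR_gt0. Qed.

Lemma gauss_weight_le1 alpha beta x v : 0 < alpha -> 0 < beta ->
  gauss_weight alpha beta x v <= 1.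
Proof.
move=> al be; rewrite -expR0 ler_expR oppr_le0.
by apply: addr_ge0; apply: mulr_ge0; rewrite ?sqr_ge0 ?ltW.
Qed.

(* The exponent is quadratic in the velocity, and the moments of order at most
   two are conserved. *)
Lemma gauss_weight_conservation alpha beta y s v w p :
  resonance_fun v w p = 0 ->
  let e u := gauss_weight alpha beta (y - s * u) u in
  e p.1 * e p.2 * e (sixth_velocity v w.1 w.2 p.1 p.2) = e v * e w.1 * e w.2.
Proof.
move=> h e; move: h; rewrite /resonance_fun /resonance !real_normK ?num_real// => h.
rewrite /e /gauss_weight -!expRD; congr expR.
set v5 := sixth_velocity _ _ _ _ _ in h *.
have v5E : v5 = v + w.1 + w.2 - p.1 - p.2 by [].
have h5 : v5 ^+ 2 = v ^+ 2 + w.1 ^+ 2 + w.2 ^+ 2 - p.1 ^+ 2 - p.2 ^+ 2 by lra.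
transitivity (- (alpha * (3 * y ^+ 2 - 2 * y * s * (p.1 + p.2 + v5) +
  s ^+ 2 * (p.1 ^+ 2 + p.2 ^+ 2 + v5 ^+ 2)) + beta * (p.1 ^+ 2 + p.2 ^+ 2 + v5 ^+ 2))).
  by ring.
by rewrite h5 v5E; ring.
Qed.

(** The integrand over the angle, with the gradient already cancelled. All other variables form one
    point of a product space, so that measurability of the collision operator follows from two
    integrations with parameters. *)
Definition collision_kernel f (z : R * R * R * (R * R)) (th : R) : R :=
  let v := z.1.2 in let w := z.2 in let p := resonant_point v w th in
  if resonant_radius v w == 0 then 0 else
  six_wave_product (f z.1.1.1 z.1.1.2 v) (f z.1.1.1 z.1.1.2 w.1) (f z.1.1.1 z.1.1.2 w.2)
    (f z.1.1.1 z.1.1.2 p.1) (f z.1.1.1 z.1.1.2 p.2)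
    (f z.1.1.1 z.1.1.2 (sixth_velocity v w.1 w.2 p.1 p.2)) / (2 * Num.sqrt 3).

Lemma measurable_joint_comp d (T : measurableType d) f (a b c : T -> R) :
  jointly_measurable f ->
  measurable_fun setT a -> measurable_fun setT b -> measurable_fun setT c ->
  measurable_fun setT (fun z => f (a z) (b z) (c z)).
Proof.
move=> mf ma mb mc.
have mabc : measurable_fun setT (fun z => (a z, b z, c z)).
  by apply: measurable_fun_pair => //; exact: measurable_fun_pair.
exact: (measurableT_comp (mf : measurable_fun _ _) mabc).
Qed.

Lemma measurable_six_wave_product d (T : measurableType d) (f f1 f2 f3 f4 f5 : T -> R) :
  measurable_fun setT f -> measurable_fun setT f1 -> measurable_fun setT f2 ->
  measurable_fun setT f3 -> measurable_fun setT f4 -> measurable_fun setT f5 ->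
  measurable_fun setT (fun z =>
    six_wave_product (f z) (f1 z) (f2 z) (f3 z) (f4 z) (f5 z)).
Proof.
move=> m m1 m2 m3 m4 m5.
have mM (a b : T -> R) : measurable_fun setT a -> measurable_fun setT b ->
  measurable_fun setT (fun z : T => a z * b z : R) by exact: measurable_funM.
have mD (a b : T -> R) : measurable_fun setT a -> measurable_fun setT b ->
  measurable_fun setT (fun z : T => a z + b z : R) by exact: measurable_funD.
by apply: measurable_funB; apply: (mM); do ?apply: (mD); do ?apply: (mM).
Qed.

Lemma measurable_collision_kernel f : jointly_measurable f ->
  measurable_fun [set: R * R * R * (R * R) * R]
    (fun z => collision_kernel f z.1 z.2).
Proof.
move=> mf.
pose T := (R * R * R * (R * R) * R)%type.
have mt : measurable_fun [set: T] (fun z => z.1.1.1.1).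
  by do 4 (apply: (measurableT_comp measurable_fst)); exact: measurable_id.
have mx : measurable_fun [set: T] (fun z => z.1.1.1.2).
  apply: (measurableT_comp measurable_snd).
  by do 3 (apply: (measurableT_comp measurable_fst)); exact: measurable_id.
have mv : measurable_fun [set: T] (fun z => z.1.1.2).
  apply: (measurableT_comp measurable_snd).
  by do 2 (apply: (measurableT_comp measurable_fst)); exact: measurable_id.
have mw : measurable_fun [set: T] (fun z => z.1.2).
  apply: (measurableT_comp measurable_snd).
  by (apply: (measurableT_comp measurable_fst)); exact: measurable_id.
have mw1 : measurable_fun [set: T] (fun z => z.1.2.1).
  exact: (measurableT_comp measurable_fst mw).
have mw2 : measurable_fun [set: T] (fun z => z.1.2.2).
  exact: (measurableT_comp measurable_snd mw).
have mth : measurable_fun [set: T] (fun z => z.2).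
  by apply: (measurableT_comp measurable_snd); exact: measurable_id.
have mradius : measurable_fun [set: T] (fun z => resonant_radius z.1.1.2 z.1.2).
  apply: measurable_sqrt; apply: measurable_funM => //.
  by do 2?apply: measurable_funD; apply: measurable_funX; apply: measurable_funB.
have mcenter : measurable_fun [set: T] (fun z => resonant_center z.1.1.2 z.1.2).
  by apply: measurable_funM => //; do 2?apply: measurable_funD.
have mp : measurable_fun [set: T] (fun z => resonant_point z.1.1.2 z.1.2 z.2).
  exact: measurable_ellipse_point.
have mp1 : measurable_fun [set: T] (fun z => (resonant_point z.1.1.2 z.1.2 z.2).1).
  exact: (measurableT_comp measurable_fst mp).
have mp2 : measurable_fun [set: T] (fun z => (resonant_point z.1.1.2 z.1.2 z.2).2).
  exact: (measurableT_comp measurable_snd mp).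
apply: measurable_fun_ifT => //; first exact: measurable_fun_eqr.
apply: measurable_funM => //.
apply: measurable_six_wave_product; apply: measurable_joint_comp => //.
by do 2?apply: measurable_funB => //; do 2?apply: measurable_funD.
Qed.

Lemma collision6E f t x v : jointly_measurable f ->
  collision6 f t x v = \int[(leb \x leb)%E]_(w in setT)
    \int[leb]_(th in `]- pi, pi]) collision_kernel f (t, x, v, w) th.
Proof.
move=> mf; apply: eq_Rintegral => w _.
rewrite -(@delta_integral_resonance _ v w (fun p =>
  six_wave_product (f t x v) (f t x w.1) (f t x w.2)
    (f t x p.1) (f t x p.2) (f t x (sixth_velocity v w.1 w.2 p.1 p.2))))//.
by apply: measurable_six_wave_product; apply: measurable_joint_comp => //;
  do 2?apply: measurable_funB.
Qed.

(* The sigma-finite structure of the library on [m1 \x m2] is not found by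
   canonical inference, hence this copy. *)
Definition plane_measure := (leb \x leb)%E.

HB.instance Definition _ := Measure.copy plane_measure (leb \x leb)%E.

Let sigma_finite_plane_measure : sigma_finite setT plane_measure.
Proof.
pose B (n : nat) : set R := `[- n%:R, n%:R]%classic.
exists (fun n => B n `*` B n) => [|n].
  apply/seteqP; split => // -[x y] _.
  exists (maxn (Num.truncn `|x|) (Num.truncn `|y|)).+1 => //.
  have xN : `|x| <= (maxn (Num.truncn `|x|) (Num.truncn `|y|)).+1%:R.
    by rewrite (le_trans (ltW (truncnS_gt _)))// ler_nat ltnS leq_maxl.
  have yN : `|y| <= (maxn (Num.truncn `|x|) (Num.truncn `|y|)).+1%:R.
    by rewrite (le_trans (ltW (truncnS_gt _)))// ler_nat ltnS leq_maxr.
  by split; rewrite /B/= in_itv/= -ler_norml.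
have mB : measurable (B n : set (measurableTypeR R)) by exact: measurable_itv.
split; first exact: measurableX.
have lB : (leb (B n) < +oo)%E.
  by rewrite /B lebesgue_measure_itv/=; case: ifPn => _; rewrite -?EFinB ltry.
by rewrite /plane_measure product_measure1E// lte_mul_pinfty// ge0_fin_numE.
Qed.

HB.instance Definition _ := Measure_isSigmaFinite.Build _ _ _ plane_measure
  sigma_finite_plane_measure.

Lemma measurable_collision6 f : jointly_measurable f ->
  jointly_measurable (collision6 f).
Proof.
move=> mf; rewrite /jointly_measurable.
rewrite (_ : (fun p => _) = fun p : R * R * R => \int[(leb \x leb)%E]_(w in setT)
    \int[leb]_(th in `]- pi, pi]) collision_kernel f (p, w) th); last first.
  by apply/funext => -[[t x] v]; exact: collision6E.
have mI : measurable_fun [set: R * R * R * (R * R)]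
    (fun z => \int[leb]_(th in `]- pi, pi]) collision_kernel f z th).
  exact: (measurable_Rintegral_param leb _ (measurable_collision_kernel mf)).
exact: (@measurable_Rintegral_param _ _ (R * R * R)%type
  (measurableTypeR R * measurableTypeR R)%type R plane_measure setT measurableT
  (fun z => \int[leb]_(th in `]- pi, pi]) collision_kernel f z th) mI).
Qed.

End Collision.

Section CollisionEstimate.
Context {R : realType}.
Implicit Types (alpha beta M D t x v s u : R) (w : R * R) (f : R -> R -> R -> R).
Local Notation leb := (@lebesgue_measure R).

Lemma measurable_gauss_weight d (T : measurableType d) alpha beta (a b : T -> R) :
  measurable_fun setT a -> measurable_fun setT b ->
  measurable_fun setT (fun z => gauss_weight alpha beta (a z) (b z)).
Proof.
move=> ma mb; apply: measurableT_comp => //; apply: measurable_funN.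
by apply: measurable_funD; apply: measurable_funM => //; exact: measurable_funX.
Qed.

Lemma addr_sqr_gt0 alpha beta s : 0 < alpha -> 0 < beta ->
  0 < alpha * s ^+ 2 + beta.
Proof. by move=> al be; rewrite ltr_wpDl// mulr_ge0 ?sqr_ge0// ltW. Qed.

(** By Tonelli the integral is the square of a one-variable Gaussian integral, each factor
    contributing the power [1 / 2] of the decay. *)
Lemma gaussian_pair_integral alpha beta x v s : 0 < alpha -> 0 < beta ->
  let e u := gauss_weight alpha beta (x + s * v - s * u) u in
  (leb \x leb)%E.-integrable setT (fun w => (e w.1 * e w.2)%:E) /\
  \int[(leb \x leb)%E]_w (e w.1 * e w.2) <= pi / (alpha * s ^+ 2 + beta).
Proof.
move=> al be e; set r := pi / _.
have e0 u : 0 <= e u by apply/ltW/gauss_weight_gt0.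
have eE u : e u = expR (- (alpha * (x + s * (v - u)) ^+ 2 + beta * u ^+ 2)).
  by rewrite /e /gauss_weight mulrBr addrA.
have me : measurable_fun [set: R] e.
  apply: measurable_gauss_weight => //.
  by apply: measurable_funB => //; exact: measurable_funM.
have mE : measurable_fun [set: R * R] (fun w => (e w.1 * e w.2)%:E).
  apply/measurable_EFinP; apply: measurable_funM.
    exact: (measurableT_comp me measurable_fst).
  exact: (measurableT_comp me measurable_snd).
have r0 : 0 <= r by rewrite divr_ge0 ?pi_ge0// ltW// addr_sqr_gt0.
have J : (\int[leb]_u (e u)%:E <= (Num.sqrt r)%:E)%E.
  apply: le_trans (integral_gaussian_le x s v al be).
  rewrite le_eqVlt; apply/orP; left; apply/eqP; apply: eq_integral => u _.
  by rewrite eE.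
have J0 : (0 <= \int[leb]_u (e u)%:E)%E by apply: integral_ge0 => u _; rewrite lee_fin.
have I : (\int[(leb \x leb)%E]_w (e w.1 * e w.2)%:E <= r%:E)%E.
  rewrite fubini_tonelli1//; last first.
    by move=> w; rewrite lee_fin mulr_ge0.
  rewrite /fubini_F/=.
  have e0E u : (0 <= (e u)%:E)%E by rewrite lee_fin.
  have meE : measurable_fun [set: measurableTypeR R] (EFin \o e).
    exact/measurable_EFinP.
  have inner u : (\int[leb]_z (e u * e z)%:E = (e u)%:E * \int[leb]_z (e z)%:E)%E.
    by under eq_integral do rewrite EFinM; apply: ge0_integralZl.
  under eq_integral do rewrite inner.
  rewrite ge0_integralZr//.
  apply: (@le_trans _ _ ((Num.sqrt r)%:E * (Num.sqrt r)%:E)%E).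
    exact: lee_pmul.
  by rewrite -EFinM -expr2 sqr_sqrtr.
have iE : (leb \x leb)%E.-integrable setT (fun w => (e w.1 * e w.2)%:E).
  apply/integrableP; split; first exact: mE.
  apply: (le_lt_trans _ (ltry r)); apply: le_trans I.
  rewrite le_eqVlt; apply/orP; left; apply/eqP; apply: eq_integral => w _.
  by rewrite gee0_abs// lee_fin mulr_ge0.
split => //; rewrite -lee_fin /Rintegral fineK//.
exact: (integrable_fin_num measurableT iE).
Qed.

(** The constant is the length [2 * pi] of the angle interval, times [1 / (2 * Num.sqrt 3)] from the
    gradient, times [pi] from the pair of Gaussian integrals. *)
Definition collision_rate alpha beta s : R :=
  pi ^+ 2 / Num.sqrt 3 / (alpha * s ^+ 2 + beta).

Lemma close_within_collision6 alpha beta M D s f g :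
  0 < alpha -> 0 < beta -> 0 <= M -> 0 <= D ->
  jointly_measurable f -> jointly_measurable g ->
  (forall x v, close_within (M * gauss_weight alpha beta x v)
    (D * gauss_weight alpha beta x v)
    (transport (- s) (f s) x v) (transport (- s) (g s) x v)) ->
  forall x v, close_within
    (6 * M ^+ 5 * collision_rate alpha beta s * gauss_weight alpha beta x v)
    (30 * M ^+ 4 * D * collision_rate alpha beta s * gauss_weight alpha beta x v)
    (transport (- s) (collision6 f s) x v) (transport (- s) (collision6 g s) x v).
Proof.
move=> al be M0 D0 mf mg fg x v; rewrite /transport mulNr opprK.
set y := x + s * v.
(* The collision takes place at the single position [y], but the moving-frame bound at velocity [u]
   refers to the point [y - s * u]. For [u = v] this is [x], which gives back the weight of the
   conclusion. *)
pose e u := gauss_weight alpha beta (y - s * u) u.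
have ev : e v = gauss_weight alpha beta x v by rewrite /e /y addrK.
have He u : close_within (M * e u) (D * e u) (f s y u) (g s y u).
  by have := fg (y - s * u) u; rewrite /transport mulNr opprK subrK.
have e1 u : e u <= 1 by exact: gauss_weight_le1.
have e0 u : 0 <= e u by exact/ltW/gauss_weight_gt0.
pose q : R := (2 * Num.sqrt 3)^-1.
have q0 : 0 <= q by rewrite invr_ge0 mulr_ge0// sqrtr_ge0.
have HK w th : close_within (6 * M ^+ 5 * (e v * e w.1 * e w.2) * q)
    (30 * M ^+ 4 * D * (e v * e w.1 * e w.2) * q)
    (collision_kernel f (s, y, v, w) th) (collision_kernel g (s, y, v, w) th).
  rewrite /collision_kernel; cbn [fst snd]; case: ifPn => [_|r0].
    by apply: close_within0; rewrite !mulr_ge0 ?exprn_ge0.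
  apply: close_withinMr => //.
  have E := gauss_weight_conservation alpha beta y s (resonance_fun_point v w th).
  exact: (close_within_six_wave_product M0 D0 (e1 _) (e1 _) (e1 _) (e1 _) (e1 _) (e1 _) E
    (He _) (He _) (He _) (He _) (He _) (He _)).
pose I h w := \int[leb]_(th in `]- pi, pi]) collision_kernel h (s, y, v, w) th.
have mK h : jointly_measurable h -> measurable_fun [set: R * R * R]
    (fun z : R * R * R => collision_kernel h (s, y, v, z.1) z.2).
  move=> mh; have m := measurable_collision_kernel mh.
  apply: (measurableT_comp m (g := fun z : R * R * R => (s, y, v, z.1, z.2))).
  by apply: measurable_fun_pair => //; apply: measurable_fun_pair.
have mKw h w : jointly_measurable h -> measurable_fun [set: R]
    (collision_kernel h (s, y, v, w)).
  move=> mh; have := mK h mh => m.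
  apply: (measurableT_comp m (g := fun z : R => (w, z))).
  exact: measurable_fun_pair.
have mI h : jointly_measurable h -> measurable_fun [set: R * R] (I h).
  by move=> mh; exact: (measurable_Rintegral_param leb _ (mK h mh)).
have pi_pos := pi_gt0 R.
have lebI : leb `]- pi, pi]%classic = (2 * pi)%:E.
  rewrite lebesgue_measure_itv/= lte_fin ifT; last by lra.
  by rewrite -EFinB; congr EFin; ring.
have icst c : leb.-integrable `]- pi, pi] (EFin \o (fun=> c)).
  apply/integrableP; split; first exact: measurable_cst.
  by rewrite integral_cst//= lebI -EFinM ltry.
have Rcst c : \int[leb]_(th in `]- pi, pi]) c = c * (2 * pi).
  by rewrite Rintegral_cst//= lebI.
have HI w : close_within (6 * M ^+ 5 * (e v * e w.1 * e w.2) * q * (2 * pi))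
    (30 * M ^+ 4 * D * (e v * e w.1 * e w.2) * q * (2 * pi)) (I f w) (I g w).
  rewrite -!Rcst; apply: close_within_Rintegral => //.
  - by apply: measurable_funTS; exact: mKw.
  - by apply: measurable_funTS; exact: mKw.
have [iG leG] := gaussian_pair_integral x v s al be.
rewrite -/y -/e in iG leG.
have iZ c : (leb \x leb)%E.-integrable setT (EFin \o (fun w => c * (e w.1 * e w.2))).
  exact: integrable_scale.
have RZ c : \int[(leb \x leb)%E]_w (c * (e w.1 * e w.2)) =
    c * \int[(leb \x leb)%E]_w (e w.1 * e w.2) by exact: RintegralZl.
rewrite !collision6E//.
pose c1 := 6 * M ^+ 5 * e v * q * (2 * pi).
pose c2 := 30 * M ^+ 4 * D * e v * q * (2 * pi).
have M5 : 0 <= M ^+ 5 by exact: exprn_ge0.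
have M4 : 0 <= M ^+ 4 by exact: exprn_ge0.
have c10 : 0 <= c1 by rewrite /c1; move: (M ^+ 5) M5 => m m0; rewrite !mulr_ge0// ltW.
have c20 : 0 <= c2 by rewrite /c2; move: (M ^+ 4) M4 => m m0; rewrite !mulr_ge0// ltW.
have := @close_within_Rintegral _ _ _ (leb \x leb)%E setT measurableT (I f) (I g)
  (fun w => c1 * (e w.1 * e w.2)) (fun w => c2 * (e w.1 * e w.2))
  (mI f mf) (mI g mg) (iZ c1) (iZ c2).
rewrite !RZ => H; apply: close_within_le (H _) => [| |w _]; last first.
- have -> : c1 * (e w.1 * e w.2) =
      6 * M ^+ 5 * (e v * e w.1 * e w.2) * q * (2 * pi) by rewrite /c1; ring.
  have -> : c2 * (e w.1 * e w.2) =
      30 * M ^+ 4 * D * (e v * e w.1 * e w.2) * q * (2 * pi) by rewrite /c2; ring.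
  exact: HI.
- have -> : 30 * M ^+ 4 * D * collision_rate alpha beta s * gauss_weight alpha beta x v =
      c2 * (pi / (alpha * s ^+ 2 + beta)).
    rewrite -ev /c2 /collision_rate /q; field.
    by rewrite sqrtr_eq0 -ltNge ltr0n gt_eqF// addr_sqr_gt0.
  exact: ler_wpM2l.
- have -> : 6 * M ^+ 5 * collision_rate alpha beta s * gauss_weight alpha beta x v =
      c1 * (pi / (alpha * s ^+ 2 + beta)).
    rewrite -ev /c1 /collision_rate /q; field.
    by rewrite sqrtr_eq0 -ltNge ltr0n gt_eqF// addr_sqr_gt0.
  exact: ler_wpM2l.
Qed.

End CollisionEstimate.

(** * The collision rate *)

Section CollisionRate.
Context {R : realType} (alpha beta : R).
Hypotheses (al : 0 < alpha) (be : 0 < beta).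
Implicit Types (s a b k : R).
Local Notation leb := (@lebesgue_measure R).
Local Notation rate := (collision_rate alpha beta).

Definition total_rate : R := pi ^+ 3 / Num.sqrt 3 * (Num.sqrt (alpha * beta))^-1.

(** Normalized to vanish at 0, hence odd, with limits [total_rate / 2] and [- total_rate / 2].
    Oddness lets the two ends of time share one formula. *)
Definition rate_primitive s : R :=
  total_rate / pi * atan (Num.sqrt (alpha * beta) / beta * s).

Lemma collision_rate_gt0 s : 0 < rate s.
Proof.
apply: divr_gt0; last exact: addr_sqr_gt0.
by rewrite divr_gt0 ?exprn_gt0 ?pi_gt0 ?sqrtr_gt0.
Qed.

Lemma total_rate_gt0 : 0 < total_rate.
Proof.
apply: mulr_gt0; last by rewrite invr_gt0 sqrtr_gt0 mulr_gt0.
by rewrite divr_gt0// ?exprn_gt0 ?pi_gt0// sqrtr_gt0.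
Qed.

Lemma continuous_collision_rate : continuous rate.
Proof.
move=> s; apply: cvgM; first exact: cvg_cst.
apply: cvgV; first by rewrite gt_eqF// addr_sqr_gt0.
apply: cvgD; last exact: cvg_cst.
by apply: cvgM; [exact: cvg_cst|exact: exprn_continuous].
Qed.

Lemma is_derive_rate_primitive s : is_derive s 1 rate_primitive (rate s).
Proof.
apply: is_derive_eq.
rewrite /collision_rate /total_rate /GRing.scale/=.
have q0 : (Num.sqrt 3 : R) != 0 by rewrite sqrtr_eq0 -ltNge.
have p0 : (pi : R) != 0 by rewrite gt_eqF// pi_gt0.
have r2 : Num.sqrt (alpha * beta) ^+ 2 = alpha * beta.
  by rewrite sqr_sqrtr// ltW// mulr_gt0.
have r0 : Num.sqrt (alpha * beta) != 0 by rewrite gt_eqF// sqrtr_gt0 mulr_gt0.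
move: (Num.sqrt (alpha * beta)) r2 r0 => r r2 r0.
have alE : alpha = r ^+ 2 / beta by rewrite r2 mulfK// gt_eqF.
have b0 : beta != 0 by rewrite gt_eqF.
have d0 : beta ^+ 2 + (r * s) ^+ 2 != 0.
  by rewrite gt_eqF// ltr_pwDl ?sqr_ge0// exprn_gt0.
rewrite alE; move: (pi : R) p0 => p p0; field.
by rewrite b0 q0 p0 r0 addrC -expr2 d0.
Qed.

Lemma derive1_rate_primitive : rate_primitive^`()%classic = rate.
Proof.
by apply/funext => s; rewrite derive1E; have := is_derive_rate_primitive s => ?; exact: derive_val.
Qed.

Lemma continuous_rate_primitive : continuous rate_primitive.
Proof.
move=> s; have [d _] := is_derive_rate_primitive s.
by apply/differentiable_continuous/derivable1_diffP.
Qed.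

Lemma rate_primitive_cvgy : rate_primitive s @[s --> +oo] --> total_rate / 2.
Proof.
have -> : total_rate / 2 = total_rate / pi * (pi / 2).
  by rewrite mulrA divfK// gt_eqF// pi_gt0.
apply: cvgM; first exact: cvg_cst.
apply: (cvg_comp (fun x : R => Num.sqrt (alpha * beta) / beta * x) (@atan R));
  last exact: cvgy_atan.
apply: gt0_cvgMry; last exact: cvg_id.
by rewrite divr_gt0// sqrtr_gt0 mulr_gt0.
Qed.

Lemma rate_primitiveN s : rate_primitive (- s) = - rate_primitive s.
Proof. by rewrite /rate_primitive mulrN atanN mulrN. Qed.

Lemma collision_rateN s : rate (- s) = rate s.
Proof. by rewrite /collision_rate sqrrN. Qed.

Lemma integral_rate_infty t :
  (\int[leb]_(s in `[t, +oo[) (rate s)%:E = (total_rate / 2 - rate_primitive t)%:E)%E.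
Proof.
rewrite (ge0_continuous_FTC2y _ _ rate_primitive_cvgy) ?EFinB//.
- by move=> s _; exact/ltW/collision_rate_gt0.
- by apply: continuous_subspaceT; exact: continuous_collision_rate.
- by apply: cvg_at_right_filter; exact: continuous_rate_primitive.
- by move=> s _; rewrite derive1_rate_primitive.
Qed.

Lemma integral_Ninfty_rate t :
  (\int[leb]_(s in `]-oo, t]) (rate s)%:E = (total_rate / 2 + rate_primitive t)%:E)%E.
Proof.
rewrite -[t]opprK ge0_integration_by_substitutionNy; last 2 first.
- by apply: continuous_subspaceT; exact: continuous_collision_rate.
- by move=> s _; exact/ltW/collision_rate_gt0.
rewrite rate_primitiveN -integral_rate_infty.
by apply: eq_integral => s _; rewrite /= collision_rateN.
Qed.

Lemma integral_rate : (\int[leb]_s (rate s)%:E = total_rate%:E)%E.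
Proof.
rewrite ge0_symfun_integralT; last 3 first.
- by move=> s; exact/ltW/collision_rate_gt0.
- exact: continuous_collision_rate.
- by move=> s; rewrite /= collision_rateN.
rewrite -set_itvcy integral_rate_infty /rate_primitive mulr0 atan0 mulr0 subr0.
by rewrite -EFinM mulrC divfK.
Qed.

Lemma integrable_rate : leb.-integrable setT (EFin \o rate).
Proof.
apply/integrableP; split.
  by apply/measurable_EFinP; apply: continuous_measurable_fun; exact: continuous_collision_rate.
under eq_integral do rewrite /= ger0_norm ?ltW ?collision_rate_gt0//.
by rewrite integral_rate ltry.
Qed.

Lemma rate_primitive_bounds s : `|rate_primitive s| <= total_rate / 2.
Proof.
rewrite /rate_primitive normrM ger0_norm; last first.
  by rewrite divr_ge0 ?pi_ge0// ltW// total_rate_gt0.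
have -> : total_rate / 2 = total_rate / pi * (pi / 2).
  by rewrite mulrA divfK// gt_eqF// pi_gt0.
rewrite ler_wpM2l//; first by rewrite divr_ge0 ?pi_ge0// ltW// total_rate_gt0.
by rewrite ler_norml !ltW ?atan_gtNpi2 ?atan_ltpi2.
Qed.

Let expF k c s : R := expR (k * (rate_primitive s - c)).

Let is_derive_expF k c s : is_derive s 1 (expF k c) (k * rate s * expF k c s).
Proof.
have ? := is_derive_rate_primitive s.
by apply: is_derive_eq; rewrite /GRing.scale/= /expF; ring.
Qed.

Let continuous_expF k c : continuous (expF k c).
Proof.
move=> s; have [d _] := is_derive_expF k c s.
by apply/differentiable_continuous/derivable1_diffP.
Qed.

Let continuous_integrand k c :
  continuous (fun s => k * rate s * expR (k * (rate_primitive s - c))).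
Proof.
move=> s; apply: cvgM; last exact: continuous_expF.
by apply: cvgM; [exact: cvg_cst|exact: continuous_collision_rate].
Qed.

Lemma integrable_rate_exp k c a b :
  leb.-integrable `[a, b] (EFin \o (fun s => k * rate s * expR (k * (rate_primitive s - c)))).
Proof.
apply: continuous_compact_integrable; first exact: segment_compact.
exact/continuous_subspaceT/continuous_integrand.
Qed.

(** This makes the Groenwall weight reproduce itself: integrating it against [k * rate] returns the
    weight up to a constant of integration. *)
Lemma Rintegral_rate_exp k c a b : a <= b ->
  \int[leb]_(s in `[a, b]) (k * rate s * expR (k * (rate_primitive s - c))) =
  expR (k * (rate_primitive b - c)) - expR (k * (rate_primitive a - c)).
Proof.
rewrite le_eqVlt => /predU1P[->|ab]; first by rewrite set_itv1 Rintegral_set1 subrr.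
rewrite /Rintegral (continuous_FTC2 (F := expF k c) ab)//.
- exact/continuous_subspaceT/continuous_integrand.
- split.
  + by move=> s _; have [] := is_derive_expF k c s.
  + by apply: cvg_at_right_filter; exact: continuous_expF.
  + by apply: cvg_at_left_filter; exact: continuous_expF.
- by move=> s _; rewrite derive1E; have ? := is_derive_expF k c s; exact: derive_val.
Qed.

End CollisionRate.

(** * Trajectories in the moving frame *)

Section Dynamics.
Context {R : realType} (alpha beta : R).
Hypotheses (al : 0 < alpha) (be : 0 < beta).
Implicit Types (M D t s a b x v : R) (f g h : R -> R -> R -> R).
Local Notation leb := (@lebesgue_measure R).
Local Notation rate := (collision_rate alpha beta).
Local Notation F := (rate_primitive alpha beta).
Local Notation W := (gauss_weight alpha beta).
Local Notation K := (total_rate alpha beta).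

Definition free_flow g : R -> R -> R -> R := fun t => transport t (g t).

Definition unflow f : R -> R -> R -> R := fun t => transport (- t) (f t).

Definition interaction g : R -> R -> R -> R := unflow (collision6 (free_flow g)).

Lemma free_flowK : cancel free_flow unflow.
Proof.
move=> g; apply/funext => t; apply/funext => x; apply/funext => v.
by rewrite /unflow /free_flow /transport mulNr opprK addrK.
Qed.

Lemma unflowK : cancel unflow free_flow.
Proof.
move=> g; apply/funext => t; apply/funext => x; apply/funext => v.
by rewrite /unflow /free_flow /transport mulNr opprK subrK.
Qed.

Lemma measurable_transport f (r : R) : jointly_measurable f ->
  jointly_measurable (fun t => transport (r * t) (f t)).
Proof.
move=> mf; have mt : measurable_fun [set: R * R * R] (fun p => p.1.1).
  by apply: (measurableT_comp measurable_fst); exact: measurable_fst.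
have mx : measurable_fun [set: R * R * R] (fun p => p.1.2).
  by apply: (measurableT_comp measurable_snd); exact: measurable_fst.
apply: (@measurable_joint_comp _ _ (R * R * R)%type f (fun p => p.1.1)
  (fun p => p.1.2 - r * p.1.1 * p.2) (fun p => p.2)) => //;
  last exact: measurable_snd.
by apply: measurable_funB => //; apply: measurable_funM => //; exact: measurable_funM.
Qed.

Lemma measurable_free_flow g : jointly_measurable g -> jointly_measurable (free_flow g).
Proof.
move=> /(measurable_transport 1).
by rewrite (_ : (fun t => _) = free_flow g)//; apply/funext => t; rewrite mul1r.
Qed.

Lemma measurable_unflow f : jointly_measurable f -> jointly_measurable (unflow f).
Proof.
move=> /(measurable_transport (-1)).
by rewrite (_ : (fun t => _) = unflow f)//; apply/funext => t; rewrite mulN1r.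
Qed.

Lemma measurable_interaction g : jointly_measurable g ->
  jointly_measurable (interaction g).
Proof.
move=> mg; exact (measurable_unflow (measurable_collision6 (measurable_free_flow mg))).
Qed.

Lemma measurable_interaction_time g x v : jointly_measurable g ->
  measurable_fun [set: R] (fun s => interaction g s x v).
Proof. by move=> /measurable_interaction mg; exact: measurable_joint_comp. Qed.

Definition weight_bounded M g := forall t x v, `|g t x v| <= M * W x v.

Lemma close_within_interaction M D g h s : 0 <= M -> 0 <= D ->
  jointly_measurable g -> jointly_measurable h ->
  (forall x v, close_within (M * W x v) (D * W x v) (g s x v) (h s x v)) ->
  forall x v, close_within (6 * M ^+ 5 * rate s * W x v)
    (30 * M ^+ 4 * D * rate s * W x v) (interaction g s x v) (interaction h s x v).
Proof.
move=> M0 D0 mg mh gh; apply: close_within_collision6 => //.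
- exact: measurable_free_flow.
- exact: measurable_free_flow.
- by move=> x v; have := gh x v; rewrite -{1}(free_flowK g) -{1}(free_flowK h).
Qed.

Lemma interaction_bound M g s x v : 0 <= M -> jointly_measurable g ->
  weight_bounded M g -> `|interaction g s x v| <= 6 * M ^+ 5 * W x v * rate s.
Proof.
move=> M0 mg gM; rewrite mulrAC.
have : forall x v, close_within (M * W x v) (M * W x v) (g s x v) (g s x v).
  move=> y u; split => //; rewrite subrr normr0 mulr_ge0//.
  exact/ltW/gauss_weight_gt0.
by move=> /(close_within_interaction M0 M0 mg mg)/(_ x v)[].
Qed.

Lemma integrable_scaled_rate (c : R) : leb.-integrable setT (EFin \o (fun s => c * rate s)).
Proof.
by apply: integrable_scale => //; exact: integrable_rate.
Qed.

Lemma integrable_interaction M g x v : 0 <= M -> jointly_measurable g ->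
  weight_bounded M g -> leb.-integrable setT (EFin \o (fun s => interaction g s x v)).
Proof.
move=> M0 mg gM; apply: le_normr_integrable (integrable_scaled_rate (6 * M ^+ 5 * W x v)) _ => //.
  exact: measurable_interaction_time.
by move=> s _; exact: interaction_bound.
Qed.

(** The increment form singles out no base time, so it follows both from the mild equation, based at
    time 0, and from the scattering equation, based at infinity. *)
Definition trajectory g := forall a b x v, a <= b ->
  g b x v - g a x v = \int[leb]_(s in `[a, b]) interaction g s x v.

Lemma rate_primitive_nondecreasing : {homo F : s t / s <= t}.
Proof.
move=> s t st; rewrite /rate_primitive ler_wpM2l//.
  by rewrite divr_ge0 ?pi_ge0// ltW// total_rate_gt0.
by apply: le_atan; rewrite ler_wpM2l// divr_ge0 ?sqrtr_ge0// ltW.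
Qed.

Lemma close_within_increment M g h (e : R -> R) a b x v : 0 <= M ->
  jointly_measurable g -> jointly_measurable h ->
  weight_bounded M g -> weight_bounded M h -> trajectory g -> trajectory h ->
  a <= b -> leb.-integrable `[a, b] (EFin \o e) ->
  (forall s, s \in `[a, b] -> `|interaction g s x v - interaction h s x v| <= e s) ->
  `|(g b x v - h b x v) - (g a x v - h a x v)| <= \int[leb]_(s in `[a, b]) e s.
Proof.
move=> M0 mg mh gM hM tg th ab ie gh.
have -> : g b x v - h b x v - (g a x v - h a x v) =
  (g b x v - g a x v) - (h b x v - h a x v) by ring.
rewrite tg// th//.
have [] // := @close_within_Rintegral _ _ _ leb `[a, b]%classic _
  (fun s => interaction g s x v) (fun s => interaction h s x v)
  (fun s => 6 * M ^+ 5 * W x v * rate s) e.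
- by apply: measurable_funTS; exact: measurable_interaction_time.
- by apply: measurable_funTS; exact: measurable_interaction_time.
- by apply: (integrableS measurableT) => //; exact: integrable_scaled_rate.
- by move=> s sab; split; [exact: interaction_bound|exact: interaction_bound|exact: gh].
Qed.

(* Groenwall's lemma in the norm weighted by [exp (2 L |F t - F t0|)], with [F]
   a primitive of the rate and [L] the Lipschitz constant. *)
Lemma trajectory_stability M D g h t0 : 0 <= M -> 0 <= D ->
  jointly_measurable g -> jointly_measurable h ->
  weight_bounded M g -> weight_bounded M h -> trajectory g -> trajectory h ->
  (forall x v, `|g t0 x v - h t0 x v| <= D * W x v) ->
  forall t x v, `|g t x v - h t x v| <=
    2 * D * expR (60 * M ^+ 4 * K) * W x v.
Proof.
move=> M0 D0 mg mh gM hM tg th gh0.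
pose k := 60 * M ^+ 4.
have k0 : 0 <= k by rewrite mulr_ge0// exprn_ge0.
(* The weight is written by cases rather than with an absolute value, so that each branch is a
   smooth exponential on its side of [t0]. *)
pose E t := if t0 <= t then expR (k * (F t - F t0)) else expR (- k * (F t - F t0)).
have E1 t : 1 <= E t.
  rewrite /E -expR0; case: ifPn => [t0t|]; rewrite ler_expR.
    by rewrite mulr_ge0// subr_ge0; exact: rate_primitive_nondecreasing.
  rewrite -ltNge => /ltW tt0; rewrite mulNr -mulrN mulr_ge0// opprB subr_ge0.
  exact: rate_primitive_nondecreasing.
have EK t : E t <= expR (k * K).
  have := rate_primitive_bounds al be t; have := rate_primitive_bounds al be t0.
  rewrite !ler_norml => /andP[? ?] /andP[? ?].
  rewrite /E; case: ifPn => _; rewrite ler_expR.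
    by rewrite ler_wpM2l//; lra.
  by rewrite mulNr -mulrN ler_wpM2l//; lra.
have W0 x v : 0 <= W x v by exact/ltW/gauss_weight_gt0.
(* The integral equation improves a factor [c] to [c / 2 + D], whose fixed point is [2 * D]. The
   start [c 0] covers the trivial bound [2 * M]. *)
pose c n := 2 * D + 2 * M / 2 ^+ n.
have c0 n : 0 <= c n by rewrite addr_ge0 ?mulr_ge0// invr_ge0 exprn_ge0.
have IH n : forall t x v, `|g t x v - h t x v| <= c n * E t * W x v.
  elim: n => [|n IH] t x v.
    rewrite (le_trans (ler_normB _ _))// (le_trans (lerD (gM _ _ _) (hM _ _ _)))//.
    rewrite -mulrDl ler_wpM2r// (@le_trans _ _ (c 0%N))//; last by rewrite ler_peMr.
    by rewrite /c expr0; lra.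
  have close s : forall x v, close_within (M * W x v) (c n * E s * W x v) (g s x v) (h s x v).
    by move=> y u; split; [exact: gM|exact: hM|exact: IH].
  have lip s : `|interaction g s x v - interaction h s x v| <=
      c n / 2 * W x v * (k * rate s * E s).
    have cE0 : 0 <= c n * E s by rewrite mulr_ge0// (le_trans _ (E1 s)).
    have [_ _] := close_within_interaction M0 cE0 mg mh (close s) x v.
    by move/le_trans; apply; rewrite /k; lra.
  have cW0 : 0 <= c n / 2 * W x v by rewrite mulr_ge0// divr_ge0.
  have incr : `|(g t x v - h t x v) - (g t0 x v - h t0 x v)| <=
      c n / 2 * W x v * (E t - 1).
    have [t0t|tt0] := leP t0 t.
      apply: (le_trans (@close_within_increment M g h
        (fun s => c n / 2 * W x v * (k * rate s * expR (k * (F s - F t0))))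
        t0 t x v M0 mg mh gM hM tg th t0t _ _)).
      - by apply: integrable_scale => //; exact: integrable_rate_exp.
      - move=> s; rewrite in_itv/= => /andP[t0s _].
        by rewrite (le_trans (lip s))// /E t0s.
      rewrite RintegralZl//; last exact: integrable_rate_exp.
      by rewrite Rintegral_rate_exp// subrr mulr0 expR0 /E t0t.
    rewrite distrC.
    apply: (le_trans (@close_within_increment M g h
        (fun s => - (c n / 2 * W x v) * (- k * rate s * expR (- k * (F s - F t0))))
        t t0 x v M0 mg mh gM hM tg th (ltW tt0) _ _)).
    - by apply: integrable_scale => //; exact: integrable_rate_exp.
    - move=> s; rewrite in_itv/= => /andP[_ st0].
      rewrite (le_trans (lip s))// [leRHS](_ : _ =
        c n / 2 * W x v * (k * rate s * expR (- k * (F s - F t0)))); last by ring.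
      rewrite /E; case: ifPn => // t0s.
      have -> : s = t0 by apply/eqP; rewrite eq_le st0 t0s.
      by rewrite subrr !mulr0.
    rewrite RintegralZl//; last exact: integrable_rate_exp.
    rewrite (Rintegral_rate_exp al be _ _ (ltW tt0)) subrr mulr0 expR0 /E (lt_geF tt0).
    by rewrite mulNr -mulrN opprB.
  have cS : c n / 2 + D = c n.+1.
    by rewrite /c exprS; field; rewrite expf_neq0.
  have := ler_normD (g t x v - h t x v - (g t0 x v - h t0 x v)) (g t0 x v - h t0 x v).
  rewrite subrK => /le_trans; apply; apply: (le_trans (lerD incr (gh0 x v))).
  rewrite -cS.
  have DW : D * W x v <= c n / 2 * W x v.
    rewrite ler_wpM2r// /c mulrDl mulrAC divff// mul1r lerDl.
    by rewrite !mulr_ge0// invr_ge0 exprn_ge0.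
  have DE : 0 <= D * W x v * E t.
    by rewrite !mulr_ge0// (le_trans _ (E1 t)).
  by lra.
move=> t x v; rewrite -/k.
apply: (@ler_geometric _ _ _ (2 * M * E t * W x v)) => n.
apply: (le_trans (IH n t x v)).
apply: (@le_trans _ _ (2 * D * E t * W x v + 2 * M * E t * W x v / 2 ^+ n)).
  by rewrite /c; move: (2 ^+ n)^-1 (E t) (W x v) => q Et w; lra.
by rewrite lerD2r ler_wpM2r// ler_wpM2l// mulr_ge0.
Qed.

End Dynamics.

(** * Weighted norms as pointwise Gaussian bounds *)

Section Norms.
Context {R : realType} (alpha beta : R).
Implicit Types (m r t x v : R) (g : R -> R -> R) (f : R -> R -> R -> R).
Local Notation W := (gauss_weight alpha beta).

Lemma weighted_norm_leP g m : (weighted_norm alpha beta g <= m%:E)%E <->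
  forall x v, `|g x v| <= m * W x v.
Proof.
have E x v : (`|g x v| * expR (alpha * `|x| ^+ 2 + beta * `|v| ^+ 2) <= m) =
    (`|g x v| <= m * W x v).
  by rewrite /gauss_weight expRN !real_normK ?num_real// ler_pdivlMr// expR_gt0.
split=> [gm x v|gm].
  rewrite -E -lee_fin; apply: le_trans gm.
  by apply: ereal_sup_ubound; exists (x, v).
by apply: ge_ereal_sup => _ [[x v] _ <-]; rewrite lee_fin/= E.
Qed.

Lemma weighted_norm_ge0 g : (0 <= weighted_norm alpha beta g)%E.
Proof.
apply: (@le_trans _ _ (`|g 0 0| * expR (alpha * `|0 : R| ^+ 2 + beta * `|0 : R| ^+ 2))%:E).
  by rewrite lee_fin mulr_ge0// expR_ge0.
by apply: ereal_sup_ubound; exists (0, 0).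
Qed.

Lemma weighted_spaceP g : weighted_space alpha beta g <->
  measurable_fun [set: R * R] (fun p => g p.1 p.2) /\
  exists m, forall x v, `|g x v| <= m * W x v.
Proof.
split=> [[mg gy]|[mg [m gm]]]; split => //.
  have gf : weighted_norm alpha beta g \is a fin_num.
    by rewrite ge0_fin_numE// weighted_norm_ge0.
  by exists (fine (weighted_norm alpha beta g)); apply/weighted_norm_leP; rewrite fineK.
by apply: (le_lt_trans _ (ltry m)); exact/weighted_norm_leP.
Qed.

Lemma weighted_ballP g r : weighted_ball alpha beta r g <->
  measurable_fun [set: R * R] (fun p => g p.1 p.2) /\
  exists2 m, m < r & forall x v, `|g x v| <= m * W x v.
Proof.
split=> [[[mg gy] gr]|[mg [m mr gm]]].
  split => //; have gf : weighted_norm alpha beta g \is a fin_num.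
    by rewrite ge0_fin_numE// weighted_norm_ge0.
  exists (fine (weighted_norm alpha beta g)); first by rewrite -lte_fin fineK.
  by apply/weighted_norm_leP; rewrite fineK.
split; first by apply/weighted_spaceP; split => //; exists m.
by apply: (@le_lt_trans _ _ m%:E); [exact/weighted_norm_leP|rewrite lte_fin].
Qed.

Lemma time_weighted_norm_ltyP f : (time_weighted_norm alpha beta f < +oo)%E <->
  exists2 M, 0 <= M & weight_bounded alpha beta M f.
Proof.
split=> [fy|[M M0 fM]]; last first.
  apply: (le_lt_trans _ (ltry M)); apply: ge_ereal_sup => _ [t _ <-].
  by apply/weighted_norm_leP; exact: fM.
have leT t : (weighted_norm alpha beta (f t) <= time_weighted_norm alpha beta f)%E.
  by apply: ereal_sup_ubound; exists t.
have T0 := le_trans (weighted_norm_ge0 (f 0)) (leT 0).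
have Tf : time_weighted_norm alpha beta f \is a fin_num by rewrite ge0_fin_numE.
exists (fine (time_weighted_norm alpha beta f)); first by rewrite fine_ge0.
by move=> t; apply/weighted_norm_leP; rewrite fineK.
Qed.

End Norms.

Section IntegralIncrement.
Context {R : realType} (Q : R -> R).
Local Notation leb := (@lebesgue_measure R).
Hypothesis iQ : leb.-integrable setT (EFin \o Q).

Lemma Rintegral_increment a b : a <= b ->
  \int[leb]_(s in `]-oo, b]) Q s - \int[leb]_(s in `]-oo, a]) Q s =
  \int[leb]_(s in `[a, b]) Q s.
Proof.
move=> ab; rewrite Rintegral_itvB//.
- rewrite Rintegral_itv_obnd_cbnd//.
  exact: (integrableS measurableT).
- exact: (integrableS measurableT).
Qed.

Lemma oriented_integralE a b : oriented_integral a b Q =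
  \int[leb]_(s in `]-oo, b]) Q s - \int[leb]_(s in `]-oo, a]) Q s.
Proof.
rewrite /oriented_integral; case: leP => [ab|ba]; first by rewrite Rintegral_increment.
by rewrite -Rintegral_increment ?ltW// opprB.
Qed.

Lemma Rintegral_complement t :
  \int[leb]_(s in `]-oo, t]) Q s - \int[leb]_s Q s =
  - \int[leb]_(s in `[t, +oo[) Q s.
Proof.
rewrite -opprB; congr (- _); rewrite -set_itvE Rintegral_itvB//.
- rewrite Rintegral_itv_obnd_cbnd//.
  exact: (integrableS measurableT).
- by rewrite set_itvE.
Qed.

End IntegralIncrement.

#[global] Instance time_infinity_filter {R : realType} plus :
  ProperFilter (@time_infinity R plus).
Proof. by case: plus => /=; typeclasses eauto. Qed.

(** * Mild solutions as trajectories, and uniqueness *)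

Section Mild.
Context {R : realType} (alpha beta : R).
Hypotheses (al : 0 < alpha) (be : 0 < beta).
Implicit Types (M m r t x v : R) (f g : R -> R -> R -> R).
Local Notation leb := (@lebesgue_measure R).
Local Notation W := (gauss_weight alpha beta).

Lemma mild_solution_trajectory (f0 : R -> R -> R) f : mild_solution alpha beta f0 f ->
  [/\ jointly_measurable (unflow f),
      exists2 M, 0 <= M & weight_bounded alpha beta M (unflow f),
      trajectory (unflow f) & unflow f 0 = f0].
Proof.
move=> [_ mf [mu /time_weighted_norm_ltyP[M M0 fM]] fE].
have mg : jointly_measurable (unflow f) by exact: measurable_unflow.
have iQ x v := integrable_interaction al be x v M0 mg fM.
have gE t x v : unflow f t x v = f0 x v +
    oriented_integral 0 t (fun s => interaction (unflow f) s x v).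
  by rewrite /interaction unflowK; exact: fE.
split => //.
- by exists M.
- move=> a b x v ab; rewrite !gE !oriented_integralE//.
  rewrite opprD addrACA subrr add0r opprB addrA subrK.
  exact: Rintegral_increment.
- by apply/funext => x; apply/funext => v; rewrite gE oriented_integralE// subrr addr0.
Qed.

Lemma trajectory_mild_solution M g : 0 <= M -> jointly_measurable g ->
  weight_bounded alpha beta M g -> trajectory g ->
  mild_solution alpha beta (g 0) (free_flow g).
Proof.
move=> M0 mg gM tg; split.
- apply/weighted_spaceP; split; last by exists M; exact: gM.
  apply: (@measurable_joint_comp _ _ (R * R)%type g (fun=> 0) fst snd) => //.
- exact: measurable_free_flow.
- rewrite -/(unflow _) free_flowK; split => //.
  by apply/time_weighted_norm_ltyP; exists M.
- have iQ x v := integrable_interaction al be x v M0 mg gM.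
  move=> t x v; rewrite -[transport _ _ _ _]/(unflow (free_flow g) t x v) free_flowK.
  rewrite -[X in oriented_integral _ _ X]/(fun s => interaction g s x v).
  apply/eqP; rewrite -subr_eq; apply/eqP.
  have [t0|/ltW t0] := leP 0 t.
    by rewrite /oriented_integral t0 -tg// opprB addrC subrK.
  by rewrite oriented_integralE// opprB Rintegral_increment// -tg// addrC subrK.
Qed.

(** The stability constant does not depend on the comparison time, so closeness at some time, which
    may vary with [e], forces equality. This form serves time 0 and the limits at infinity alike.
    The two bounds are replaced by their maximum. *)
Lemma trajectory_eq M N g h : 0 <= M -> 0 <= N ->
  jointly_measurable g -> jointly_measurable h ->
  weight_bounded alpha beta M g -> weight_bounded alpha beta N h ->
  trajectory g -> trajectory h ->
  (forall e, 0 < e -> exists t, forall x v, `|g t x v - h t x v| <= e * W x v) ->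
  g = h.
Proof.
move=> M0 N0 mg mh gM hN tg th gh.
apply/funext => t; apply/funext => x; apply/funext => v.
apply/eqP; rewrite -subr_eq0 -normr_le0; apply/ler_addgt0Pr => e e0; rewrite add0r.
have W0 y u : 0 < W y u by exact: gauss_weight_gt0.
have maxM : weight_bounded alpha beta (Num.max M N) g.
  by move=> s y u; rewrite (le_trans (gM s y u))// ler_wpM2r ?le_max ?lexx ?orbT ?(ltW (W0 _ _)).
have maxN : weight_bounded alpha beta (Num.max M N) h.
  by move=> s y u; rewrite (le_trans (hN s y u))// ler_wpM2r ?le_max ?lexx ?orbT ?(ltW (W0 _ _)).
have max0 : 0 <= Num.max M N by rewrite le_max M0.
pose L := expR (60 * Num.max M N ^+ 4 * total_rate alpha beta).
have L0 : 0 < L by exact: expR_gt0.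
have e1 : 0 < e / (2 * L * W x v) by rewrite divr_gt0// !mulr_gt0.
have [t0 gh0] := gh _ e1.
have := trajectory_stability al be max0 (ltW e1) mg mh maxM maxN tg th gh0 t x v.
move=> /le_trans; apply; rewrite -/L le_eqVlt; apply/orP; left; apply/eqP; field.
by rewrite !gt_eqF.
Qed.

Lemma mild_solution_unique (f0 : R -> R -> R) f f' : mild_solution alpha beta f0 f ->
  mild_solution alpha beta f0 f' -> f = f'.
Proof.
move=> /mild_solution_trajectory[mg [M M0 gM] tg g0].
move=> /mild_solution_trajectory[mh [N N0 hN] th h0].
apply: (can_inj (@unflowK R)).
apply: (trajectory_eq M0 N0 mg mh gM hN tg th) => e e0.
exists 0 => x v; rewrite g0 h0 subrr normr0 mulr_ge0// ltW//.
exact: gauss_weight_gt0.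
Qed.

Lemma scatters_near plus f (phi : R -> R -> R) e : scatters alpha beta plus f phi ->
  0 < e -> \forall t \near time_infinity plus,
    forall x v, `|unflow f t x v - phi x v| <= e * W x v.
Proof.
move=> sf e0.
have e0' : (0 < e%:E)%E by rewrite lte_fin.
have : \forall t \near time_infinity plus, (weighted_norm alpha beta
    (fun x v => transport (- t) (f t) x v - phi x v)%R < e%:E)%E.
  apply: (sf [set y | (y < e%:E)%E]); apply: open_nbhs_nbhs; split => //.
  exact: open_ereal_lt_ereal.
by apply: filterS => t /ltW /weighted_norm_leP.
Qed.

Lemma scattering_injective plus (f0 h0 phi : R -> R -> R) f h :
  mild_solution alpha beta f0 f -> mild_solution alpha beta h0 h ->
  scatters alpha beta plus f phi -> scatters alpha beta plus h phi -> f0 = h0.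
Proof.
move=> /mild_solution_trajectory[mg [M M0 gM] tg <-].
move=> /mild_solution_trajectory[mh [N N0 hN] th <-] sf sh.
congr (_ 0); apply: (trajectory_eq M0 N0 mg mh gM hN tg th) => e e0.
have e2 : 0 < e / 2 by rewrite divr_gt0.
have [t [ft ht]] := filter_ex (filterI (scatters_near sf e2) (scatters_near sh e2)).
exists t => x v; rewrite (le_trans (ler_distD (phi x v) _ _))//.
by rewrite (splitr e) mulrDl lerD// distrC.
Qed.

End Mild.

(** * Existence of scattering trajectories *)

Section WaveMap.
Context {R : realType} (alpha beta : R).
Hypotheses (al : 0 < alpha) (be : 0 < beta).
Implicit Types (M D r c t s x v : R) (g h : R -> R -> R -> R).
Local Notation leb := (@lebesgue_measure R).
Local Notation rate := (collision_rate alpha beta).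
Local Notation F := (rate_primitive alpha beta).
Local Notation W := (gauss_weight alpha beta).
Local Notation K := (total_rate alpha beta).

Lemma normr_Rintegral_rate (A : set (measurableTypeR R)) (Q : R -> R) c :
  measurable A -> measurable_fun [set: R] Q -> (forall s, `|Q s| <= c * rate s) ->
  `|\int[leb]_(s in A) Q s| <= c * \int[leb]_(s in A) rate s.
Proof.
move=> mA mQ Qc.
have ir : leb.-integrable A (EFin \o rate).
  by apply: (integrableS measurableT) => //; exact: integrable_rate.
have icr : leb.-integrable A (EFin \o (fun s => c * rate s)) by exact: integrable_scale.
rewrite -RintegralZl//.
have [] // := @close_within_Rintegral _ _ _ leb A mA Q Q
  (fun s => c * rate s) (fun s => c * rate s).
- exact: measurable_funTS.
- exact: measurable_funTS.
- move=> s _; split => //; rewrite subrr normr0.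
  exact: le_trans (Qc s).
Qed.

Lemma Rintegral_rate_le (A : set (measurableTypeR R)) : measurable A ->
  \int[leb]_(s in A) rate s <= K.
Proof.
move=> mA; rewrite -[leRHS]/(fine K%:E) -(integral_rate al be).
have ir := integrable_rate al be.
apply: fine_le.
- by apply: (integrable_fin_num mA); exact: (integrableS measurableT).
- exact: (integrable_fin_num measurableT ir).
apply: ge0_subset_integral => //.
- by have /integrableP[] := ir.
- by move=> s _; rewrite lee_fin ltW// collision_rate_gt0.
Qed.

(* The integral equation satisfied by the trajectory that tends to [phi] at
   [+oo] if [plus], at [-oo] otherwise. *)
Definition wave_map plus (phi : R -> R -> R) g : R -> R -> R -> R := fun t x v =>
  phi x v + (\int[leb]_(s in `]-oo, t]) interaction g s x v -
    if plus then \int[leb]_s interaction g s x v else 0).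

Lemma measurable_wave_map plus (phi : R -> R -> R) g :
  measurable_fun [set: R * R] (fun p => phi p.1 p.2) ->
  jointly_measurable g -> jointly_measurable (wave_map plus phi g).
Proof.
move=> mphi mg.
have mQ := measurable_interaction mg.
pose T3 := (R * R * R)%type.
have m11 : measurable_fun [set: T3 * R] (fun z => z.1.1.1).
  apply: (measurableT_comp measurable_fst).
  by apply: (measurableT_comp measurable_fst); exact: measurable_fst.
have mQ4 : measurable_fun [set: T3 * R] (fun z => interaction g z.2 z.1.1.2 z.1.2).
  apply: (@measurable_joint_comp _ _ (T3 * R)%type (interaction g) snd (fun z => z.1.1.2)
    (fun z => z.1.2)) => //.
  - apply: (measurableT_comp measurable_snd).
    by apply: (measurableT_comp measurable_fst); exact: measurable_fst.
  - by apply: (measurableT_comp measurable_snd); exact: measurable_fst.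
have mE : measurable_fun [set: T3]
    (fun p => \int[leb]_s interaction g s p.1.2 p.2).
  exact: (@measurable_Rintegral_param _ _ T3 (measurableTypeR R) R leb _ measurableT _ mQ4).
have mI : measurable_fun [set: T3]
    (fun p => \int[leb]_(s in `]-oo, p.1.1]) interaction g s p.1.2 p.2).
  (* The moving endpoint goes into the integrand, so that the domain of integration no longer
     depends on the parameters. *)
  have -> : (fun p : T3 => \int[leb]_(s in `]-oo, p.1.1]) interaction g s p.1.2 p.2) =
    fun p => \int[leb]_s (if s <= p.1.1 then interaction g s p.1.2 p.2 else 0).
    apply/funext => p; rewrite Rintegral_mkcond; apply: eq_Rintegral => s _.
    by rewrite patchE mem_setE in_itv.
  apply: (@measurable_Rintegral_param _ _ T3 (measurableTypeR R) R leb _ measurableT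
    (fun z => if z.2 <= z.1.1.1 then interaction g z.2 z.1.1.2 z.1.2 else 0)).
  apply: measurable_fun_ifT => //.
  exact: measurable_fun_ler.
rewrite /jointly_measurable /wave_map; apply: measurable_funD.
  apply: (@measurableT_comp _ _ _ _ _ _ (fun p : R * R => phi p.1 p.2) _
    (fun p : T3 => (p.1.2, p.2))) => //.
  apply: measurable_fun_pair => //.
  by apply: (measurableT_comp measurable_snd); exact: measurable_fst.
by apply: measurable_funB => //; case: plus.
Qed.

(** The factor 60 is twice the Lipschitz constant 30: at [+oo] the correction is a difference of two
    integrals, and each is bounded by the total rate. *)
Lemma wave_map_lipschitz plus (phi : R -> R -> R) M D g h t x v : 0 <= M -> 0 <= D ->
  jointly_measurable g -> jointly_measurable h ->
  weight_bounded alpha beta M g -> weight_bounded alpha beta M h ->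
  (forall t x v, `|g t x v - h t x v| <= D * W x v) ->
  `|wave_map plus phi g t x v - wave_map plus phi h t x v| <=
    60 * M ^+ 4 * K * D * W x v.
Proof.
move=> M0 D0 mg mh gM hM gh.
have W0 : 0 <= W x v by exact/ltW/gauss_weight_gt0.
have iQ f : jointly_measurable f -> weight_bounded alpha beta M f ->
    leb.-integrable setT (EFin \o (fun s => interaction f s x v)).
  by move=> mf fM; exact: (integrable_interaction al be x v M0 mf fM).
pose c := 30 * M ^+ 4 * D * W x v.
have c0 : 0 <= c by rewrite !mulr_ge0// exprn_ge0.
have bound (A : set (measurableTypeR R)) : measurable A ->
    `|\int[leb]_(s in A) interaction g s x v - \int[leb]_(s in A) interaction h s x v| <= c * K.
  move=> mA; rewrite -RintegralB//.
  - apply: le_trans (ler_wpM2l c0 (Rintegral_rate_le mA)).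
    apply: normr_Rintegral_rate => //.
      by apply: measurable_funB; exact: measurable_interaction_time.
    move=> s; have clo y u : close_within (M * W y u) (D * W y u) (g s y u) (h s y u).
      by split; [exact: gM|exact: hM|exact: gh].
    have [_ _] := close_within_interaction al be M0 D0 mg mh clo x v.
    by rewrite /c mulrAC.
  - by apply: (integrableS measurableT) => //; exact: iQ.
  - by apply: (integrableS measurableT) => //; exact: iQ.
have bT := bound setT measurableT.
have bt : `|\int[leb]_(s in `]-oo, t]) interaction g s x v -
    \int[leb]_(s in `]-oo, t]) interaction h s x v| <= c * K by exact: bound.
have -> : 60 * M ^+ 4 * K * D * W x v = c * K + c * K by rewrite /c; ring.
rewrite /wave_map; case: plus.
  have E (p a b a' b' : R) : p + (a - b) - (p + (a' - b')) = (a - a') - (b - b').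
    by ring.
  by rewrite E (le_trans (ler_normB _ _))// lerD.
have E (p a a' : R) : p + (a - 0) - (p + (a' - 0)) = a - a' by ring.
rewrite E; apply: (le_trans bt); rewrite lerDl.
by apply: mulr_ge0 => //; exact/ltW/total_rate_gt0.
Qed.

(** The correction is an integral from [t] to the chosen end of time, hence bounded by the mass of
    the rate there. The estimate gives both the size of the image and the convergence to [phi]. *)
Lemma wave_map_tail plus (phi : R -> R -> R) M g t x v : 0 <= M ->
  jointly_measurable g -> weight_bounded alpha beta M g ->
  `|wave_map plus phi g t x v - phi x v| <=
    6 * M ^+ 5 * W x v * (K / 2 + F (if plus then - t else t)).
Proof.
move=> M0 mg gM; rewrite /wave_map addrC addKr.
have mQ := measurable_interaction_time x v mg.
have Qb s := interaction_bound al be s x v M0 mg gM.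
case: plus.
  rewrite Rintegral_complement; last exact: (integrable_interaction al be x v M0 mg gM).
  rewrite normrN rate_primitiveN.
  have <- : \int[leb]_(s in `[t, +oo[) rate s = K / 2 - F t.
    by rewrite /Rintegral integral_rate_infty.
  exact: normr_Rintegral_rate.
rewrite subr0.
have <- : \int[leb]_(s in `]-oo, t]) rate s = K / 2 + F t.
  by rewrite /Rintegral integral_Ninfty_rate.
exact: normr_Rintegral_rate.
Qed.

Lemma wave_map_bounded plus (phi : R -> R -> R) M r g : 0 <= M ->
  jointly_measurable g -> weight_bounded alpha beta M g ->
  (forall x v, `|phi x v| <= r * W x v) ->
  weight_bounded alpha beta (r + 6 * M ^+ 5 * K) (wave_map plus phi g).
Proof.
move=> M0 mg gM phir t x v.
have W0 : 0 <= W x v by exact/ltW/gauss_weight_gt0.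
rewrite -[wave_map _ _ _ _ _ _](subrK (phi x v)) addrC.
rewrite (le_trans (ler_normD _ _))// mulrDl lerD//.
apply: (le_trans (wave_map_tail plus phi t x v M0 mg gM)).
rewrite -[leRHS]mulrAC ler_wpM2l//; first by rewrite !mulr_ge0// exprn_ge0.
have := rate_primitive_bounds al be (if plus then - t else t).
by rewrite ler_norml => /andP[_ ?]; lra.
Qed.

Lemma wave_map_fixpoint_trajectory plus (phi : R -> R -> R) M g : 0 <= M ->
  jointly_measurable g -> weight_bounded alpha beta M g ->
  wave_map plus phi g = g -> trajectory g.
Proof.
move=> M0 mg gM gE a b x v ab.
have <- := Rintegral_increment (integrable_interaction al be x v M0 mg gM) ab.
have E (p q r c : R) : p + (q - c) - (p + (r - c)) = q - r by ring.
by rewrite -{1 2}gE /wave_map E.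
Qed.

(** Picard iterates from 0 stay within the bound [M] by the last hypothesis, and successive
    differences halve by the one before it. Limits are chosen point by point with error
    [2 * M / 2 ^+ n] times the weight; being pointwise, they remain jointly measurable. *)
Lemma wave_map_fixpoint plus (phi : R -> R -> R) M r : 0 <= M ->
  measurable_fun [set: R * R] (fun p => phi p.1 p.2) ->
  (forall x v, `|phi x v| <= r * W x v) ->
  120 * M ^+ 4 * K <= 1 -> r + 6 * M ^+ 5 * K <= M ->
  exists g, [/\ jointly_measurable g, weight_bounded alpha beta M g &
    wave_map plus phi g = g].
Proof.
move=> M0 mphi phir contr rM.
have W0 x v : 0 <= W x v by exact/ltW/gauss_weight_gt0.
pose u n := iter n (wave_map plus phi) (fun _ _ _ => 0).
have uM n : jointly_measurable (u n) /\ weight_bounded alpha beta M (u n).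
  elim: n => [|n [mu ub]].
    by split; [exact: measurable_cst|move=> t x v; rewrite normr0 mulr_ge0].
  split; first exact: measurable_wave_map.
  move=> t x v; apply: (le_trans (wave_map_bounded plus M0 mu ub phir t x v)).
  by rewrite ler_wpM2r.
have half D x v : 0 <= D -> 60 * M ^+ 4 * K * D * W x v <= D / 2 * W x v.
  move=> D0; rewrite ler_wpM2r//.
  by have := ler_wpM2r D0 contr; lra.
have step n : forall t x v, `|u n.+1 t x v - u n t x v| <= M / 2 ^+ n * W x v.
  elim: n => [|n IH] t x v.
    by rewrite /u/= subr0 expr0 divr1; exact: (uM 1%N).2.
  have D0 : 0 <= M / 2 ^+ n by rewrite divr_ge0// exprn_ge0.
  apply: (le_trans (wave_map_lipschitz plus phi t x v M0 D0 (uM n.+1).1 (uM n).1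
    (uM n.+1).2 (uM n).2 IH)).
  apply: (le_trans (half _ x v D0)); rewrite le_eqVlt; apply/orP; left; apply/eqP.
  by rewrite exprS; field; rewrite expf_neq0.
have lim (p : R * R * R) : exists l, forall n,
    `|u n p.1.1 p.1.2 p.2 - l| <= 2 * (M * W p.1.2 p.2) / 2 ^+ n.
  apply: geometric_limit => n; apply: (le_trans (step n _ _ _)).
  by rewrite mulrAC.
have {lim}[gp gpP] := choice lim.
pose g t x v := gp (t, x, v).
have ug n t x v : `|u n t x v - g t x v| <= 2 * M / 2 ^+ n * W x v.
  by have := gpP (t, x, v) n; rewrite mulrA mulrAC.
have mg : jointly_measurable g.
  apply: (measurable_fun_cvg (fun n => (uM n).1)) => -[[t x] v] _.
  exact: (cvg_geometric_dist (gpP (t, x, v))).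
have gM : weight_bounded alpha beta M g.
  move=> t x v; apply: (@ler_geometric _ _ _ (2 * M * W x v)) => n.
  have := ug n t x v; have := (uM n).2 t x v => uMn.
  rewrite mulrAC => ugn.
  rewrite -(subKr (u n t x v) (g t x v)) (le_trans (ler_normB _ _))//.
  exact: lerD.
exists g; split => //.
apply/funext => t; apply/funext => x; apply/funext => v.
apply/eqP; rewrite -subr_eq0 -normr_le0.
apply: (@ler_geometric _ _ _ (2 * M * W x v)) => n; rewrite add0r.
have D0 : 0 <= 2 * M / 2 ^+ n by rewrite divr_ge0 ?exprn_ge0// mulr_ge0.
have ugn s y w : `|g s y w - u n s y w| <= 2 * M / 2 ^+ n * W y w by rewrite distrC.
rewrite (le_trans (ler_distD (u n.+1 t x v) _ _))//.
have h1 := wave_map_lipschitz plus phi t x v M0 D0 mg (uM n).1 gM (uM n).2 ugn.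
have h2 := ug n.+1 t x v.
have h3 := half _ x v D0.
apply: (le_trans (lerD (le_trans h1 h3) h2)).
rewrite le_eqVlt; apply/orP; left; apply/eqP.
by rewrite exprS; field; rewrite expf_neq0.
Qed.

End WaveMap.

Section Existence.
Context {R : realType} (alpha beta : R).
Hypotheses (al : 0 < alpha) (be : 0 < beta).
Implicit Types (M r t x v : R) (g : R -> R -> R -> R).
Local Notation F := (rate_primitive alpha beta).
Local Notation W := (gauss_weight alpha beta).
Local Notation K := (total_rate alpha beta).

Lemma rate_tail_cvg plus :
  K / 2 + F (if plus then - t else t) @[t --> time_infinity plus] --> 0.
Proof.
have Fy : K / 2 - F t @[t --> +oo] --> 0.
  rewrite -[X in _ --> X](subrr (K / 2)).
  by apply: cvgB; [exact: cvg_cst|exact: rate_primitive_cvgy].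
case: plus; first by under eq_fun do rewrite rate_primitiveN.
apply/cvgNy_compNP; apply: cvg_trans Fy; apply: near_eq_cvg.
by near=> t; rewrite /= rate_primitiveN.
Unshelve. all: by end_near.
Qed.

Lemma scattering_exists plus (phi : R -> R -> R) M r : 0 <= M ->
  measurable_fun [set: R * R] (fun p => phi p.1 p.2) ->
  (forall x v, `|phi x v| <= r * W x v) ->
  120 * M ^+ 4 * K <= 1 -> r + 6 * M ^+ 5 * K <= M ->
  exists f0 f, [/\ forall x v, `|f0 x v| <= (r + 6 * M ^+ 5 * K) * W x v,
    mild_solution alpha beta f0 f & scatters alpha beta plus f phi].
Proof.
move=> M0 mphi phir contr rM.
have [g [mg gM gE]] := wave_map_fixpoint al be plus M0 mphi phir contr rM.
have tg := wave_map_fixpoint_trajectory al be M0 mg gM gE.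
exists (g 0), (free_flow g); split.
(* Reading the bound off the fixed-point equation gives a value that may be smaller than [M]; this
   yields the strict inequality of the open ball. *)
- by move=> x v; rewrite -gE; exact: wave_map_bounded.
- exact: (trajectory_mild_solution al be M0 mg gM tg).
rewrite /scatters.
pose tail t := 6 * M ^+ 5 * (K / 2 + F (if plus then - t else t)).
have tail0 : (tail t)%:E @[t --> time_infinity plus] --> 0%E.
  apply: cvg_EFin; first by near=> t.
  rewrite -(mulr0 (6 * M ^+ 5)); apply: cvgM; first exact: cvg_cst.
  exact: rate_tail_cvg.
apply: (squeeze_cvge _ (cvg_cst 0%E) tail0); near=> t.
rewrite weighted_norm_ge0/=; apply/weighted_norm_leP => x v.
rewrite -[transport _ _ _ _]/(unflow (free_flow g) t x v) free_flowK -{1}gE /tail.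
rewrite (le_trans (wave_map_tail al be plus phi t x v M0 mg gM))//.
by rewrite mulrAC.
Unshelve. all: by end_near.
Qed.

End Existence.

(** * The numerical constants *)

Section Constants.
Context {R : realType}.
Implicit Types (alpha beta Rs : R).

(** The fourth power of the hypothesis is [Rs ^+ 4 <= Num.sqrt alpha / (2 ^+ 14 * C1beta 16 beta)],
    and [pi <= 4] bounds the total rate by [64 / (Num.sqrt alpha * Num.sqrt beta)]. As
    [120 * 2 ^+ 4 = 1920], the final value is [1920 * 64 / 2 ^+ 17 = 15 / 16]. *)
Lemma small_data alpha beta Rs : 0 < alpha -> 0 < beta -> 0 < Rs ->
  Rs <= alpha `^ (1 / 8) / (2 `^ (7 / 2) * C1beta 16 beta `^ (1 / 4)) ->
  120 * (2 * Rs) ^+ 4 * total_rate alpha beta <= 1.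
Proof.
move=> al be Rs0 RsE.
have C0 : 0 < C1beta 16 beta.
  by rewrite !mulr_gt0 ?powR_gt0// addr_gt0// invr_gt0.
have pow4 (a p : R) : 0 < a -> (a `^ p) ^+ 4 = a `^ (p * 4).
  by move=> a0; rewrite -powR_mulrn ?powR_ge0// -powRrM.
have R4 : Rs ^+ 4 <= Num.sqrt alpha / (2 ^+ 14 * C1beta 16 beta).
  apply: (le_trans (lerXn2r 4 _ _ RsE)).
  - by rewrite nnegrE ltW.
  - by rewrite nnegrE divr_ge0 ?mulr_ge0 ?powR_ge0.
  rewrite !exprMn exprVn exprMn !pow4//.
  have -> : (1 / 8 * 4 : R) = 2^-1 by field.
  have -> : (7 / 2 * 4 : R) = 14%:R by field.
  have -> : (1 / 4 * 4 : R) = 1 by field.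
  by rewrite powR12_sqrt ?(ltW al)// powR_mulrn// powRr1 ?(ltW C0).
have sal : 0 < Num.sqrt alpha by rewrite sqrtr_gt0.
have sbe : 0 < Num.sqrt beta by rewrite sqrtr_gt0.
have q3 : 1 <= Num.sqrt 3 :> R by rewrite -[leLHS]sqrtr1 ler_wsqrtr// ler1n.
have K_le : total_rate alpha beta <= 64 / (Num.sqrt alpha * Num.sqrt beta).
  rewrite /total_rate sqrtrM ?(ltW al)// ler_wpM2r//.
  rewrite ler_pdivrMr; last exact: lt_le_trans q3.
  apply: (@le_trans _ _ (4 ^+ 3)); last first.
    have -> : (64 : R) = 4 ^+ 3 by ring.
    by rewrite ler_peMr// exprn_ge0.
  by rewrite lerXn2r ?nnegrE ?pi_ge0//; have := @pihalf_lt2 R; lra.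
(* The factor [beta^-1 + 1] absorbs the [1 / Num.sqrt beta] of the total rate, uniformly in
   [beta]. *)
have C_ge : 8 <= Num.sqrt beta * C1beta 16 beta.
  rewrite /C1beta powRN (_ : 1 / 2 = 2^-1) ?div1r// powR12_sqrt//.
  have q2 : 2^-1 <= (Num.sqrt 2)^-1 :> R.
    rewrite lef_pV2 ?posrE ?sqrtr_gt0//.
    by rewrite -(@ler_pXn2r _ 2) ?nnegrE ?sqrtr_ge0// sqr_sqrtr// expr2; lra.
  have b1 : 1 <= Num.sqrt beta * (beta^-1 + 1).
    rewrite -{2}(sqr_sqrtr (ltW be)) -(ler_pM2l sbe).
    have -> : Num.sqrt beta * (Num.sqrt beta * ((Num.sqrt beta ^+ 2)^-1 + 1)) =
        1 + Num.sqrt beta ^+ 2 by field; rewrite gt_eqF.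
    by nra.
  have b0 : 0 <= Num.sqrt beta * (beta^-1 + 1) by exact: le_trans b1.
  have := ler_pM (ltac:(by []) : 0 <= 2^-1 :> R) ler01 q2 b1.
  by lra.
have K0 := total_rate_gt0 al be.
have := ler_pM (exprn_ge0 4 (ltW Rs0)) (ltW K0) R4 K_le.
set q := _ * _ => RK.
have {RK} : Rs ^+ 4 * total_rate alpha beta <= 64 / (2 ^+ 14 * (Num.sqrt beta * C1beta 16 beta)).
  apply: (le_trans RK); rewrite /q le_eqVlt; apply/orP; left; apply/eqP; field.
  by rewrite !gt_eqF.
move: (Num.sqrt beta * _) C_ge => y y8 RK; have y0 : 0 < y by lra.
have {RK} : Rs ^+ 4 * total_rate alpha beta <= 64 / (2 ^+ 14 * 8).
  apply: (le_trans RK); rewrite ler_wpM2l// lef_pV2 ?posrE ?mulr_gt0//.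
  by rewrite ler_wpM2l.
have -> : 120 * (2 * Rs) ^+ 4 * total_rate alpha beta =
  1920 * (Rs ^+ 4 * total_rate alpha beta) by ring.
by lra.
Qed.

End Constants.

Theorem theorem2p7 (R : realType) :
  exists C1 : R, 0 < C1 /\
    forall alpha beta Rs : R,
      0 < alpha -> 0 < beta -> 0 < Rs ->
      Rs <= alpha `^ (1 / 8) / (2 `^ (7 / 2) * C1beta C1 beta `^ (1 / 4)) ->
      forall (plus : bool) (fpm : R -> R -> R),
        weighted_ball alpha beta Rs fpm ->
        exists! f0 : R -> R -> R,
          weighted_ball alpha beta (2 * Rs) f0 /\
          exists f : R -> R -> R -> R,
            unique (mild_solution alpha beta f0) f /\
            scatters alpha beta plus f fpm.
Proof.
(* [16] suffices with the crude bounds [pi <= 4] and [Num.sqrt 2 <= 2]. *)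
exists 16; split => // alpha beta Rs al be Rs0 RsE plus fpm.
move=> /weighted_ballP[mfpm [r rRs fpmr]].
have small := small_data al be Rs0 RsE.
have M0 : 0 <= 2 * Rs by rewrite mulr_ge0// ltW.
(* With [M = 2 * Rs], smallness gives [6 * M ^+ 5 * K <= M / 20 = Rs / 10], where [K] is the total
   rate, so the sum is even below [11 / 10 * Rs]. *)
have rM : r + 6 * (2 * Rs) ^+ 5 * total_rate alpha beta < 2 * Rs.
  have := ler_wpM2r M0 small; rewrite [(2 * Rs) ^+ 5]exprSr; lra.
have [f0 [f [f0r mf sf]]] := scattering_exists al be plus M0 mfpm fpmr small (ltW rM).
exists f0; split; last first.
  by move=> h0 [_ [h [[mh _] sh]]]; exact: (scattering_injective al be mf mh sf sh).
split.
  apply/weighted_ballP; split; first by have [[]] := mf.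
  by exists (r + 6 * (2 * Rs) ^+ 5 * total_rate alpha beta).
exists f; split => //; split => // h mh; exact: (mild_solution_unique al be mf mh).
Qed.
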